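(* The set $B\subseteq\mathbb{R}^2$ defined in the context has computable measure $0$. Hence there is, in every direction in $\mathbb{R}^2$, a line that contains no computably random point.
   Context: For $m,b\in\mathbb{R}$ let $\mathcal{L}_{m,b}=\{(x,y): y=mx+b\}$, and for $F\subseteq\mathbb{R}^2$ let $\mathcal{L}(F)=\bigcup\{\mathcal{L}_{m,b}:(m,b)\in F\}$. Let $\Sigma=\{0,1,2,3\}$, $a_0=2,a_1=0,a_2=3,a_3=1$, and $S_i(x,y)=\frac14((x,y)+(i,a_i))$ for $i\in\Sigma$. Define $F(\lambda)=[0,1]^2$ and $F(iw)=S_i(F(w))$ for $i\in\Sigma$, $w\in\Sigma^*$; $F_k=\bigcup_{w\in\Sigma^k}F(w)$; $F=\bigcap_{k\ge0}F_k$. With $\mathrm{Ref}_Y$ the reflection across the $y$-axis and $\mathrm{Rot}_{\pi/2}$ rotation about the origin by $\pi/2$, let $B=\mathcal{L}(F)\cup\mathrm{Rot}_{\pi/2}(\mathcal{L}(F))\cup\mathrm{Ref}_Y\big(\mathcal{L}(F)\cup\mathrm{Rot}_{\pi/2}(\mathcal{L}(F))\big)$. Measure notions in $\mathbb{R}^n$: for $r\in\mathbb{N}$, $\mathbf{u}\in\mathbb{Z}^n$, $Q_r(\mathbf{u})=\prod_{i=1}^n[u_i2^{-r},(u_i+1)2^{-r})$; $\mathcal{Q}_r=\{Q_r(\mathbf{u}):\mathbf{u}\in\{0,\dots,2^r-1\}^n\}$, $\mathcal{Q}=\bigcup_r\mathcal{Q}_r$. A martingale is $d:\mathcal{Q}\to[0,\infty)$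 with $d(Q_r(\mathbf{u}))=2^{-n}\sum_{\mathbf{a}\in\{0,1\}^n}d(Q_{r+1}(2\mathbf{u}+\mathbf{a}))$. For $\mathbf{x}\in[0,1)^n$, $d^{(r)}(\mathbf{x})=d(Q)$ for the $Q\in\mathcal{Q}_r$ containing $\mathbf{x}$; $d$ succeeds at $\mathbf{x}$ if $\limsup_{r}d^{(r)}(\mathbf{x})=\infty$. Let $J=\{(r,\mathbf{u}):r\in\mathbb{N},\mathbf{u}\in\{0,\dots,2^r-1\}^n\}$. $d$ is computable if there is a computable $\widehat d:\mathbb{N}\times J\to\mathbb{Q}\cap[0,\infty)$ with $|\widehat d(s,r,\mathbf{u})-d(Q_r(\mathbf{u}))|\le2^{-s}$ for all $(s,r,\mathbf{u})$. For $E\subseteq\mathbb{R}^n$ let $E^\#=[0,1)^n\cap\bigcup_{\mathbf{t}\in\mathbb{Z}^n}(E+\mathbf{t})$. $E$ has computable measure $0$ if some computable martingale succeeds at every point of $E^\#$. A point $\mathbf{x}\in\mathbb{R}^n$ is computably random if it belongs to no set of computable measure $0$. A line is in the direction of a nonzero vector $\mathbf{v}$ if it is parallel to $\mathbf{v}$. *)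

(* Defs.v *)
From mathcomp Require Import all_boot all_order all_algebra.
From mathcomp Require Import boolp classical_sets functions reals.
From mathcomp Require Import constructive_ereal ereal topology normedtype.
From mathcomp Require Import sequences.

Set Implicit Arguments.
Unset Strict Implicit.
Unset Printing Implicit Defensive.
Import Order.TTheory GRing.Theory Num.Theory.

Local Open Scope classical_set_scope.
Local Open Scope ring_scope.

(* The total computable functions nat^k -> nat, as Kleene's general recursive
   functions: minimization is only applied to functions that have a zero along
   the searched argument.  In [rec_prim] and [rec_min] the new function is
   given by its defining equations. *)
Inductive recursive : forall k : nat, (k.-tuple nat -> nat) -> Prop :=
| rec_zero k : recursive (fun _ : k.-tuple nat => 0%N)
| rec_succ : recursive (fun x : 1.-tuple nat => (thead x).+1)
| rec_proj k (i : 'I_k) : recursive (fun x : k.-tuple nat => tnth x i)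
| rec_comp k m (f : m.-tuple nat -> nat) (g : 'I_m -> k.-tuple nat -> nat) :
    recursive f -> (forall i, recursive (g i)) ->
    recursive (fun x => f [tuple g i x | i < m])
| rec_prim k (f : k.-tuple nat -> nat) (g : k.+2.-tuple nat -> nat)
      (h : k.+1.-tuple nat -> nat) :
    recursive f -> recursive g ->
    (forall x : k.-tuple nat, h [tuple of 0%N :: x] = f x) ->
    (forall (y : nat) (x : k.-tuple nat),
      h [tuple of y.+1 :: x] =
      g [tuple of y :: h [tuple of y :: x] :: x]) ->
    recursive h
| rec_min k (f : k.+1.-tuple nat -> nat) (h : k.-tuple nat -> nat) :
    recursive f ->
    (forall x : k.-tuple nat, f [tuple of h x :: x] = 0%N) ->
    (forall (x : k.-tuple nat) (y : nat),
      (y < h x)%N -> f [tuple of y :: x] <> 0%N) ->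
    recursive h.

(* J is the set of (r, u) with u in {0, ..., 2^r - 1}^n, which indexes the
   dyadic cubes contained in [0, 1)^n. *)
Definition in_J (n r : nat) (u : 'rV[int]_n) : Prop :=
  forall i, 0 <= u 0 i < 2 ^+ r.

Definition J_code (n s r : nat) (u : 'rV[int]_n) : n.+2.-tuple nat :=
  [tuple of s :: r :: [tuple absz (u 0 i) | i < n]].

(* Computability of a function N * J -> Q /\ [0, oo): numerator and
   (positive) denominator are computed separately.  Since J is decidable, a
   computable function on N * J is the restriction of a total one; the values
   of [dhat] outside N * J are irrelevant. *)
Definition computable_on_J (n : nat) (dhat : nat -> nat -> 'rV[int]_n -> rat) :
    Prop :=
  exists num den : n.+2.-tuple nat -> nat,
    [/\ recursive num, recursive den &
        forall (s r : nat) (u : 'rV[int]_n), in_J r u ->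
          (0 < den (J_code s r u))%N /\
          dhat s r u = (num (J_code s r u))%:R / (den (J_code s r u))%:R].

Section Measure.
Variables (R : realType) (n : nat).
Implicit Types (r : nat) (u t : 'rV[int]_n) (x : 'rV[R]_n).
Implicit Types (d : set 'rV[R]_n -> R) (E : set 'rV[R]_n).

Definition dyadic_cube r u : set 'rV[R]_n :=
  [set x | forall i, (u 0 i)%:~R * 2 ^- r <= x 0 i < (u 0 i + 1)%:~R * 2 ^- r].

Definition dyadic_cubes r : set (set 'rV[R]_n) :=
  [set dyadic_cube r u | u in [set u | in_J r u]].

(* Only the values of [d] on the cubes in the union of the [dyadic_cubes r]
   matter; elsewhere [d] is arbitrary and unconstrained. *)
Definition martingale d : Prop :=
  (forall r Q, dyadic_cubes r Q -> 0 <= d Q) /\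
  (forall r u, in_J r u ->
    d (dyadic_cube r u) =
    2 ^- n * \sum_(a : 'rV[bool]_n)
               d (dyadic_cube r.+1 (u *+ 2 + map_mx (fun b : bool => b%:Z) a))).

Definition cube_of r x : set 'rV[R]_n :=
  xget set0 [set Q | dyadic_cubes r Q /\ Q x].

Definition succeeds_at d x : Prop :=
  limn_esup (fun r => (d (cube_of r x))%:E) = +oo%E.

Definition computable_martingale d : Prop :=
  martingale d /\
  exists dhat : nat -> nat -> 'rV[int]_n -> rat,
    computable_on_J dhat /\
    forall (s : nat) r u, in_J r u ->
      `|ratr (dhat s r u) - d (dyadic_cube r u)| <= 2 ^- s.

Definition unit_cube : set 'rV[R]_n := [set x | forall i, 0 <= x 0 i < 1].

Definition periodize E : set 'rV[R]_n :=
  unit_cube `&`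
  \bigcup_(t in [set: 'rV[int]_n]) [set x + map_mx (fun z : int => z%:~R) t | x in E].

Definition computable_measure0 E : Prop :=
  exists d, computable_martingale d /\
    forall x, periodize E x -> succeeds_at d x.

Definition computably_random x : Prop :=
  forall E, computable_measure0 E -> ~ E x.

End Measure.

Section Besicovitch.
Variable R : realType.
Implicit Types (p v : 'rV[R]_2) (A : set 'rV[R]_2).

Definition pt (x y : R) : 'rV[R]_2 := \row_(j < 2) (if j == 0 then x else y).
Definition xc p : R := p 0 0.
Definition yc p : R := p 0 1.

Definition graph_line (m b : R) : set 'rV[R]_2 := [set p | yc p = m * xc p + b].

Definition lines_of A : set 'rV[R]_2 :=
  \bigcup_(q in A) graph_line (xc q) (yc q).

Definition digit_shift (i : 'I_4) : nat := nth 0%N [:: 2; 0; 3; 1]%N i.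

Definition contraction (i : 'I_4) p : 'rV[R]_2 :=
  4^-1 *: (p + pt (i : nat)%:R (digit_shift i)%:R).

Fixpoint F_word (w : seq 'I_4) : set 'rV[R]_2 :=
  if w is i :: w' then contraction i @` F_word w'
  else [set p | 0 <= xc p <= 1 /\ 0 <= yc p <= 1].

Definition F_level (k : nat) : set 'rV[R]_2 :=
  \bigcup_(w in [set w : seq 'I_4 | size w = k]) F_word w.

Definition F_set : set 'rV[R]_2 := \bigcap_(k in [set: nat]) F_level k.

Definition refY p : 'rV[R]_2 := pt (- xc p) (yc p).
Definition rot_half_pi p : 'rV[R]_2 := pt (- yc p) (xc p).

Definition B_set : set 'rV[R]_2 :=
  let H := lines_of F_set `|` rot_half_pi @` lines_of F_set in
  H `|` refY @` H.

(* Meaningful for v != 0: L is a line parallel to v. *)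
Definition line_in_direction v (L : set 'rV[R]_2) : Prop :=
  exists p, L = [set p + t *: v | t in [set: R]].

End Besicovitch.

(* Main.v *)
(* The vertical section over [x] of the strips that cover [lines_of F_set] at
   level [k] consists of [4 ^ k] intervals of length of order [4 ^ - k], which
   start at [4 ^ - k * word_val x w].  For almost every [x] some of these
   intervals, at a common level, coincide up to an arbitrarily small proportion of
   their length: the differences of the values [word_val x w] can be steered to
   stay bounded while their slopes in [x] grow, so that in every neighborhood of
   [x] a fixed proportion of the abscissas has a near coincidence, and Lebesgue's
   density theorem applies.  By self-similarity near coincidences make the number
   of unit intervals needed to cover the values at level [k] an arbitrarily small
   multiple of [4 ^ k].  Hence the proportion of the grid squares of side
   [4 ^ - k] that meet the strips tends to 0.  A search finds, computably in [j],
   a level where the grid squares meeting the translates by at most [j] of the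
   strips have proportion at most [2 ^ - j], and the sum over [j] of the
   relative measures of these unions of squares is a martingale.  It succeeds on
   every translate of the Besicovitch set, which contains a line in every
   direction because every slope in [0, 1] is the first coordinate of a point of
   [F_set]. *)
Require Import Defs.
From mathcomp Require Import all_boot all_order all_algebra.
From mathcomp Require Import all_classical all_reals all_analysis.
From mathcomp Require Import measurable_realfun.
From mathcomp Require Import ring lra zify.
Set Implicit Arguments.
Unset Strict Implicit.
Unset Printing Implicit Defensive.
Import Order.TTheory GRing.Theory Num.Theory.
Import numFieldNormedType.Exports.

(** * Recursive functions of finite sequences *)

(** A list plays the role of an environment whose variables are read by [nth 0], as with de Bruijn
    indices; closure properties can then be proved for all arities at once. *)
Definition recfun (f : seq nat -> nat) : Prop :=
  forall n, recursive (fun x : n.-tuple nat => f x).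

Lemma recursive_ext k (f g : k.-tuple nat -> nat) :
  recursive f -> f =1 g -> recursive g.
Proof. by move=> rf /funext <-. Qed.

Lemma recfun_ext f g : recfun f -> f =1 g -> recfun g.
Proof. by move=> rf /funext <-. Qed.

Lemma recfun_nth i : recfun (fun e => nth 0 e i).
Proof.
move=> n; have [lin|nli] := ltnP i n.
  apply: recursive_ext (rec_proj (Ordinal lin)) _ => x.
  by rewrite (tnth_nth 0).
by apply: recursive_ext (rec_zero _) _ => x; rewrite nth_default ?size_tuple.
Qed.

(** The length of the new environment depends only on the length of the old one, so each arity [n]
    needs a single composition with an [l n]-ary function. *)
Lemma recfun_subst f (E : seq nat -> seq nat) l (a : nat -> seq nat -> nat) :
  recfun f -> (forall i, recfun (a i)) ->
  (forall e, E e = mkseq (a^~ e) (l (size e))) -> recfun (fun e => f (E e)).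
Proof.
move=> rf ra aE n.
apply: recursive_ext (rec_comp (rf (l n)) (fun i : 'I_(l n) => ra i n)) _ => x.
rewrite aE size_tuple; congr f.
apply: (@eq_from_nth _ 0) => [|i]; rewrite size_tuple ?size_mkseq // => lti.
by rewrite -/(nat_of_ord (Ordinal lti)) -tnth_nth tnth_mktuple nth_mkseq.
Qed.

Lemma recfun_comp f (gs : seq (seq nat -> nat)) :
  recfun f -> foldr (fun g P => recfun g /\ P) True gs ->
  recfun (fun e => f [seq g e | g <- gs]).
Proof.
move=> rf rgs; apply: (recfun_subst (l := fun=> size gs)
  (a := fun i => if i < size gs then nth (fun=> 0) gs i else fun=> 0)) => //.
  elim: gs rgs => [|g gs IH] /=; first by move=> _ i n; exact: rec_zero.
  by case=> rg rgs [|i] //=; rewrite ltnS; exact: IH.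
move=> e; apply: (@eq_from_nth _ 0); rewrite size_map ?size_mkseq // => i lti.
by rewrite nth_mkseq // lti (nth_map (fun=> 0)).
Qed.

Lemma recfun_succ f : recfun f -> recfun (fun e => (f e).+1).
Proof.
move=> rf n; apply: recursive_ext (rec_comp rec_succ (fun=> rf n)) _ => x.
by rewrite /thead tnth_mktuple.
Qed.

Lemma recfun_const c : recfun (fun=> c).
Proof. by elim: c => [n|c /recfun_succ //]; exact: rec_zero. Qed.

Lemma recfun_behead f : recfun f -> recfun (fun e => f (behead e)).
Proof.
move=> rf; apply: (recfun_subst (l := predn) (a := fun i e => nth 0 e i.+1)) => //.
  by move=> i; exact: recfun_nth.
move=> e; apply: (@eq_from_nth _ 0); rewrite size_behead ?size_mkseq // => i lti.
by rewrite nth_mkseq // nth_behead.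
Qed.

(** Bounded iteration is primitive recursion with the counter and the accumulator pushed in front of
    the environment. The arithmetic operations below all derive from it. *)
Lemma recfun_iteri n b s : recfun n -> recfun b -> recfun s ->
  recfun (fun e => iteri (n e) (fun y acc => s [:: y, acc & e]) (b e)).
Proof.
move=> rn rb rs k.
pose h (z : k.+1.-tuple nat) := iteri (thead z)
  (fun y acc => s [:: y, acc & behead_tuple z]) (b (behead_tuple z)).
have rh : recursive h by apply: rec_prim (rb k) (rs k.+2) _ _.
pose G (i : 'I_k.+1) (x : k.-tuple nat) :=
  if unlift ord0 i is Some j then tnth x j else n x.
have rG i : recursive (G i).
  rewrite /G; case: unlift => [j|]; [exact: rec_proj | exact: rn].
apply: recursive_ext (rec_comp rh rG) _ => x.
suff -> : [tuple G i x | i < k.+1] = [tuple of n x :: x].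
  by rewrite /h /=.
apply: eq_from_tnth => i; rewrite tnth_mktuple /G.
by case: unliftP => [j ->|->]; rewrite ?tnthS ?tnth0.
Qed.

Lemma recfun_call1 f a : recfun (fun e => f (nth 0 e 0)) ->
  recfun a -> recfun (fun e => f (a e)).
Proof. by move=> rf ra; exact: (recfun_comp (gs := [:: a]) rf). Qed.

Lemma recfun_call3 f a b c :
  recfun (fun e => f (nth 0 e 0) (nth 0 e 1) (nth 0 e 2)) ->
  recfun a -> recfun b -> recfun c -> recfun (fun e => f (a e) (b e) (c e)).
Proof. by move=> rf ra rb rc; exact: (recfun_comp (gs := [:: a; b; c]) rf). Qed.

Lemma recfun_call4 f a b c d :
  recfun (fun e => f (nth 0 e 0) (nth 0 e 1) (nth 0 e 2) (nth 0 e 3)) ->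
  recfun a -> recfun b -> recfun c -> recfun d ->
  recfun (fun e => f (a e) (b e) (c e) (d e)).
Proof.
by move=> rf ra rb rc rd; exact: (recfun_comp (gs := [:: a; b; c; d]) rf).
Qed.

Lemma recfun_add a b : recfun a -> recfun b -> recfun (fun e => a e + b e).
Proof.
move=> ra rb; have rs : recfun (fun e => (nth 0 e 1).+1).
  exact/recfun_succ/recfun_nth.
apply: recfun_ext (recfun_iteri ra rb rs) _ => e /=.
by elim: (a e) => //= n ->.
Qed.

Lemma recfun_mul a b : recfun a -> recfun b -> recfun (fun e => a e * b e).
Proof.
move=> ra rb.
have rs : recfun (fun e => b (behead (behead e)) + nth 0 e 1).
  exact: recfun_add (recfun_behead (recfun_behead rb)) (recfun_nth 1).
apply: recfun_ext (recfun_iteri ra (recfun_const 0) rs) _ => e /=.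
by elim: (a e) => //= n ->; rewrite mulSn.
Qed.

Lemma recfun_pred a : recfun a -> recfun (fun e => (a e).-1).
Proof.
move=> ra.
apply: recfun_ext (recfun_iteri ra (recfun_const 0) (recfun_nth 0)) _ => e /=.
by case: (a e).
Qed.

Lemma recfun_sub a b : recfun a -> recfun b -> recfun (fun e => a e - b e).
Proof.
move=> ra rb.
apply: recfun_ext (recfun_iteri rb ra (recfun_pred (recfun_nth 1))) _ => e /=.
by elim: (b e) => [|n /= ->]; rewrite ?subn0 ?subnS.
Qed.

Lemma recfun_leq a b : recfun a -> recfun b ->
  recfun (fun e => (a e <= b e : nat)).
Proof.
move=> ra rb.
apply: recfun_ext (recfun_sub (recfun_const 1) (recfun_sub ra rb)) _ => e /=.
by rewrite /leq; case: (a e - b e).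
Qed.

Lemma recfun_pow a b : recfun a -> recfun b -> recfun (fun e => a e ^ b e).
Proof.
move=> ra rb.
have rs : recfun (fun e => a (behead (behead e)) * nth 0 e 1).
  exact: recfun_mul (recfun_behead (recfun_behead ra)) (recfun_nth 1).
apply: recfun_ext (recfun_iteri rb (recfun_const 1) rs) _ => e /=.
by elim: (b e) => //= n ->; rewrite expnS.
Qed.

Lemma recfun_sum n (F : nat -> seq nat -> nat) :
  recfun n -> recfun (fun e => F (nth 0 e 0) (behead e)) ->
  recfun (fun e => \sum_(0 <= i < n e) F i e).
Proof.
move=> rn rF.
have rs : recfun (fun e => nth 0 e 1 + F (nth 0 e 0) (behead (behead e))).
  apply: recfun_add (recfun_nth 1) _.
  (* The summand must not see the accumulator, so entry 1 of the environment is dropped. *)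
  apply: (recfun_subst (f := fun e => F (nth 0 e 0) (behead e))
    (E := fun e => nth 0 e 0 :: behead (behead e))
    (l := fun n => n.-2.+1) (a := fun i e => nth 0 e (if i is j.+1 then i.+1 else 0)))
    => //.
    by move=> i; exact: recfun_nth.
  move=> e; apply: (@eq_from_nth _ 0); rewrite /= !size_behead ?size_map ?size_iota //.
  by move=> [|i] lti //; rewrite nth_mkseq //= !nth_behead.
apply: recfun_ext (recfun_iteri rn (recfun_const 0) rs) _ => e /=.
by elim: (n e) => [|m IH]; rewrite ?big_nil ?big_nat1 // big_nat_recr //= IH addnC.
Qed.

(** The quotient is the number of [i < a e] with [(i + 1) * b e <= a e], hence a bounded sum of
    comparisons. *)
Lemma recfun_div a b : recfun a -> recfun b -> (forall e, 0 < b e) ->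
  recfun (fun e => a e %/ b e).
Proof.
move=> ra rb b0.
apply: recfun_ext (recfun_sum (F := fun i e => (i.+1 * b e <= a e : nat)) ra _) _.
  apply: recfun_leq; last exact: recfun_behead ra.
  apply: recfun_mul; first exact/recfun_succ/recfun_nth.
  exact: recfun_behead rb.
move=> e; have le_qa : a e %/ b e <= a e by rewrite leq_div.
rewrite big_mkord; transitivity (\sum_(i < a e) (i < a e %/ b e : nat)).
  by apply: eq_bigr => i _; rewrite -leq_divRL.
rewrite -[RHS]card_ord -sum1_card (big_ord_widen _ (fun=> 1) le_qa) [RHS]big_mkcond.
by apply: eq_bigr => i _; case: ltnP.
Qed.

Lemma recfun_div_const c a : recfun a -> recfun (fun e => a e %/ c.+1).
Proof. by move=> ra; apply: recfun_div (recfun_const c.+1) _. Qed.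

Lemma recfun_div_pow c a b : recfun a -> recfun b ->
  recfun (fun e => a e %/ c.+1 ^ b e).
Proof.
move=> ra rb; apply: recfun_div => // [|e]; last by rewrite expn_gt0.
exact: recfun_pow (recfun_const _) rb.
Qed.

(* [recfun_nth] under [behead]: the shape that variables take in the bodies of
   nested sums. *)
Lemma recfun_nth1 i : recfun (fun e => nth 0 (behead e) i).
Proof. exact: recfun_behead (recfun_nth i). Qed.

Lemma recfun_nth2 i : recfun (fun e => nth 0 (behead (behead e)) i).
Proof. exact: recfun_behead (recfun_nth1 i). Qed.

Lemma recfun_nth3 i : recfun (fun e => nth 0 (behead (behead (behead e))) i).
Proof. exact: recfun_behead (recfun_nth2 i). Qed.

Ltac recfun_tac := repeat first
  [ apply: recfun_nth | apply: recfun_nth1 | apply: recfun_nth2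
  | apply: recfun_nth3 | apply: recfun_const | apply: recfun_succ
  | apply: recfun_add | apply: recfun_mul | apply: recfun_sub
  | apply: recfun_leq | apply: recfun_div_const | apply: recfun_div_pow
  | apply: recfun_pow | apply: recfun_sum ].

Lemma recfun_min (f : nat -> nat -> bool) (h : nat -> nat) :
  recfun (fun e => (f (nth 0 e 0) (nth 0 e 1) : nat)) ->
  (forall j, f (h j) j) -> (forall j k, f k j -> h j <= k) ->
  recfun (fun e => h (nth 0 e 0)).
Proof.
move=> rf fh h_min.
have rnf : recfun (fun e => 1 - f (nth 0 e 0) (nth 0 e 1)).
  exact: recfun_sub (recfun_const 1) rf.
apply: (recfun_call1 (f := h)); last exact: recfun_nth.
(* In arity 0 the variable takes the default value 0, so the function is the constant [h 0]. *)
case=> [|n]; first by apply: recursive_ext (recfun_const (h 0) 0) _ => x; rewrite tuple0.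
have rh1 : recursive (fun x : 1.-tuple nat => h (thead x)).
  apply: rec_min (rnf 2) _ _ => [x|x y]; case/tupleP: x => j x /=; rewrite theadE.
    by rewrite fh.
  by case fyj: (f y j) => //; move/(h_min _ _): fyj; rewrite leqNgt => /negbTE ->.
apply: recursive_ext (rec_comp rh1 (fun=> rec_proj ord0)) _ => x /=.
by rewrite /thead tnth_mktuple (tnth_nth 0).
Qed.

Local Open Scope classical_set_scope.
Local Open Scope ring_scope.

(** * A martingale criterion for computable measure 0 *)

Lemma sum_even_odd (h : nat -> nat) (K : nat) :
  (\sum_(i < 2 * K) h i = \sum_(i < K) (h (2 * i)%N + h (2 * i).+1))%N.
Proof.
elim: K => [|K IH]; first by rewrite !big_ord0.
by rewrite mulnS !addSn !add0n !big_ord_recr /= IH addnA.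
Qed.

(** The two ranges on the left are consecutive and form the [2 K] integers from [2 K a] on; both
    integers of a pair [2 q], [2 q + 1] have as quotient by [2 ^ r.+1] the quotient of [q] by
    [2 ^ r]. *)
Lemma sum_dyadic_split (g : nat -> nat) (K a r : nat) :
  (\sum_(i < K) g ((K * (2 * a) + i) %/ 2 ^ r.+1) +
   \sum_(i < K) g ((K * (2 * a).+1 + i) %/ 2 ^ r.+1) =
   2 * \sum_(i < K) g ((K * a + i) %/ 2 ^ r))%N.
Proof.
transitivity (\sum_(i < 2 * K) g ((2 * (K * a) + i) %/ 2 ^ r.+1))%N.
  rewrite [(2 * K)%N]mul2n -addnn big_split_ord /=.
  congr addn; apply: eq_bigr => i _.
    by congr (g (_ %/ _)%N); lia.
  by congr (g (_ %/ _)%N); lia.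
rewrite (sum_even_odd (fun i => g ((2 * (K * a) + i) %/ 2 ^ r.+1)%N)).
rewrite [RHS]mul2n -[RHS]addnn -[RHS]big_split /=; apply: eq_bigr => i _.
have E b : (b < 2)%N ->
    ((2 * (K * a) + (2 * i + b)) %/ 2 ^ r.+1 = (K * a + i) %/ 2 ^ r)%N.
  move=> b2; rewrite expnS divnMA; congr (_ %/ _)%N.
  by rewrite addnA -mulnDr mulnC divnMDl // divn_small ?addn0.
have := E 0 isT; have := E 1 isT; rewrite addn0 addn1 => -> -> //.
Qed.

(** * Relative measures of unions of bad squares *)

Section Criterion.
Variables (bad : nat -> nat -> nat -> bool) (N : nat -> nat).

(* [4 ^ N j] times the relative measure, in the square with corner
   [(a, b) / 2 ^ r] and side [2 ^ - r], of the union of the bad squares of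
   side [2 ^ - N j]; subdividing into [4 ^ N j] squares treats the cases
   [r <= N j] and [N j <= r] uniformly. *)
Definition bad_count (j r a b : nat) : nat :=
  (\sum_(0 <= i < 2 ^ N j) \sum_(0 <= i' < 2 ^ N j)
     (bad j ((2 ^ N j * a + i) %/ 2 ^ r) ((2 ^ N j * b + i') %/ 2 ^ r) : nat))%N.

Lemma bad_countE j r a b : bad_count j r a b =
  (\sum_(i < 2 ^ N j) \sum_(i' < 2 ^ N j)
     (bad j ((2 ^ N j * a + i) %/ 2 ^ r) ((2 ^ N j * b + i') %/ 2 ^ r) : nat))%N.
Proof. by rewrite /bad_count big_mkord; under eq_bigr do rewrite big_mkord. Qed.

Lemma bad_count_split j r a b :
  (bad_count j r.+1 (2 * a) (2 * b) + bad_count j r.+1 (2 * a) (2 * b).+1 +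
   bad_count j r.+1 (2 * a).+1 (2 * b) + bad_count j r.+1 (2 * a).+1 (2 * b).+1
   = 4 * bad_count j r a b)%N.
Proof.
have splitb a' : (bad_count j r.+1 a' (2 * b) + bad_count j r.+1 a' (2 * b).+1 =
    2 * \sum_(i < 2 ^ N j) \sum_(i' < 2 ^ N j)
     (bad j ((2 ^ N j * a' + i) %/ 2 ^ r.+1) ((2 ^ N j * b + i') %/ 2 ^ r) : nat))%N.
  rewrite !bad_countE -big_split big_distrr; apply: eq_bigr => i _ /=.
  by rewrite (sum_dyadic_split (fun y => bad j _ y : nat)).
rewrite splitb -addnA splitb -mulnDr.
rewrite (sum_dyadic_split (fun x => \sum_(i' < 2 ^ N j)
  (bad j x ((2 ^ N j * b + i') %/ 2 ^ r) : nat))%N).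
by rewrite mulnA bad_countE.
Qed.

(** By [bad_count_split] the count of a square is at most four times that of its parent, all counts
    being nonnegative. *)
Lemma bad_count_le j r a b : (a < 2 ^ r)%N -> (b < 2 ^ r)%N ->
  (bad_count j r a b <= 4 ^ r * bad_count j 0 0 0)%N.
Proof.
elim: r a b => [|r IH] a b.
  by rewrite !ltnS !leqn0 => /eqP -> /eqP ->; rewrite mul1n.
move=> a2 b2.
have Ha : (a %/ 2 < 2 ^ r)%N by rewrite ltn_divLR // -expnSr.
have Hb : (b %/ 2 < 2 ^ r)%N by rewrite ltn_divLR // -expnSr.
rewrite expnS -mulnA.
have {}IH := IH _ _ Ha Hb.
rewrite -(leq_pmul2l (isT : 0 < 4)%N) in IH; apply: leq_trans IH.
rewrite -bad_count_split.
have ea : a = (2 * (a %/ 2) + odd a)%N by rewrite mulnC -modn2 -divn_eq.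
have eb : b = (2 * (b %/ 2) + odd b)%N by rewrite mulnC -modn2 -divn_eq.
by rewrite {1}ea {1}eb; case: (odd a); case: (odd b); rewrite ?addn0 ?addn1; lia.
Qed.

Lemma bad_count_full j r a b : (N j <= r)%N ->
  bad j (a %/ 2 ^ (r - N j)) (b %/ 2 ^ (r - N j)) ->
  bad_count j r a b = (4 ^ N j)%N.
Proof.
move=> Nr badj.
have E c (i : 'I_(2 ^ N j)) : ((2 ^ N j * c + i) %/ 2 ^ r = c %/ 2 ^ (r - N j))%N.
  rewrite -{1}(subnKC Nr) expnD divnMA mulnC divnMDl ?expn_gt0 //.
  by rewrite (divn_small (ltn_ord i)) addn0.
rewrite bad_countE.
under eq_bigr => i _ do under eq_bigr => i' _ do rewrite !E badj /=.
by rewrite !sum_nat_const !card_ord muln1 -expnMn.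
Qed.

Variable R : realType.
Hypothesis bad_small : forall j,
  ((\sum_(i < 2 ^ N j) \sum_(i' < 2 ^ N j) (bad j i i' : nat)) * 2 ^ j
     <= 4 ^ N j)%N.

Definition bad_frac (j r a b : nat) : R := (bad_count j r a b)%:R / 4 ^+ N j.

Lemma bad_frac_ge0 j r a b : 0 <= bad_frac j r a b.
Proof. by rewrite divr_ge0 ?ler0n ?exprn_ge0. Qed.

Lemma bad_frac_le j r a b : (a < 2 ^ r)%N -> (b < 2 ^ r)%N ->
  bad_frac j r a b <= 4 ^+ r * 2 ^- j.
Proof.
move=> ar br; have le_c := bad_count_le j ar br.
have bs : (bad_count j 0 0 0 * 2 ^ j <= 4 ^ N j)%N.
  apply: leq_trans (bad_small j); rewrite leq_mul2r; apply/orP; right.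
  rewrite bad_countE.
  apply: leq_sum => i _; apply: leq_sum => i' _.
  by rewrite !muln0 !add0n !divn1.
rewrite ler_pdivrMr ?exprn_gt0 // mulrAC ler_pdivlMr ?exprn_gt0 //.
rewrite -!natrX -!natrM ler_nat.
apply: leq_trans (_ : 4 ^ r * bad_count j 0 0 0 * 2 ^ j <= _)%N.
  by rewrite leq_mul2r le_c orbT.
by rewrite -mulnA leq_mul2l bs orbT.
Qed.

Definition bad_psum (r a b J : nat) : R := \sum_(j < J) bad_frac j r a b.

Lemma bad_psum_nondecreasing r a b : nondecreasing_seq (bad_psum r a b).
Proof.
apply/nondecreasing_seqP => J.
by rewrite /bad_psum big_ord_recr lerDl bad_frac_ge0.
Qed.

(** The terms are dominated by a geometric series; the subtracted [2 ^- (J + m)] lets the induction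
    on [m] close. *)
Lemma bad_psum_tail r a b J m : (a < 2 ^ r)%N -> (b < 2 ^ r)%N ->
  bad_psum r a b (J + m) <= bad_psum r a b J + 2 * 4 ^+ r * (2 ^- J - 2 ^- (J + m)).
Proof.
move=> ar br; elim: m => [|m IH].
  by rewrite addn0 subrr mulr0 addr0.
rewrite addnS [leLHS]big_ord_recr /= -/(bad_psum _ _ _ _).
have := bad_frac_le (J + m) ar br.
have -> : 2 ^- (J + m).+1 = 2 ^- (J + m) / 2 :> R by rewrite exprSr invfM mulrC.
move: IH; move: (bad_psum r a b (J + m)) (bad_psum r a b J) (bad_frac (J + m) r a b) => p q f; lra.
Qed.

Lemma bad_psum_le r a b J m : (a < 2 ^ r)%N -> (b < 2 ^ r)%N ->
  bad_psum r a b m <= bad_psum r a b J + 2 * 4 ^+ r * 2 ^- J.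
Proof.
move=> ar br; have [mJ|Jm] := leqP m J.
  rewrite (le_trans (bad_psum_nondecreasing r a b mJ)) // lerDl.
  by rewrite !mulr_ge0 ?exprn_ge0 // invr_ge0 exprn_ge0.
rewrite -(subnKC (ltnW Jm)); apply: le_trans (bad_psum_tail _ _ ar br) _.
rewrite lerD2l ler_pM2l ?mulr_gt0 ?exprn_gt0 // gerBl.
by rewrite invr_ge0 exprn_ge0.
Qed.

Definition bad_sum (r a b : nat) : R := limn (bad_psum r a b).

Lemma cvg_bad_psum r a b : (a < 2 ^ r)%N -> (b < 2 ^ r)%N ->
  bad_psum r a b @ \oo --> bad_sum r a b.
Proof.
move=> ar br; apply: nondecreasing_is_cvgn; first exact: bad_psum_nondecreasing.
exists (bad_psum r a b 0 + 2 * 4 ^+ r * 2 ^- 0) => _ [m _ <-].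
exact: bad_psum_le.
Qed.

Lemma bad_psum_le_sum r a b J : (a < 2 ^ r)%N -> (b < 2 ^ r)%N ->
  bad_psum r a b J <= bad_sum r a b.
Proof.
move=> ar br; apply: nondecreasing_cvgn_le.
  exact: bad_psum_nondecreasing.
exact: cvgP (cvg_bad_psum ar br).
Qed.

Lemma bad_sum_le_psum r a b J : (a < 2 ^ r)%N -> (b < 2 ^ r)%N ->
  bad_sum r a b <= bad_psum r a b J + 2 * 4 ^+ r * 2 ^- J.
Proof.
move=> ar br; apply: limr_le; first exact: cvgP (cvg_bad_psum ar br).
by near=> m; exact: bad_psum_le.
Unshelve. all: by end_near. Qed.

Lemma bad_sum_ge0 r a b : (a < 2 ^ r)%N -> (b < 2 ^ r)%N -> 0 <= bad_sum r a b.
Proof.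
move=> ar br; apply: le_trans (bad_psum_le_sum 0 ar br).
by rewrite /bad_psum big_ord0.
Qed.

Lemma bad_sum_split r a b : (a < 2 ^ r)%N -> (b < 2 ^ r)%N ->
  bad_sum r.+1 (2 * a) (2 * b) + bad_sum r.+1 (2 * a) (2 * b).+1 +
  bad_sum r.+1 (2 * a).+1 (2 * b) + bad_sum r.+1 (2 * a).+1 (2 * b).+1
  = 4 * bad_sum r a b.
Proof.
move=> ar br.
have [a0 b0] : (2 * a < 2 ^ r.+1 /\ 2 * b < 2 ^ r.+1)%N by rewrite expnS; lia.
have [a1 b1] : ((2 * a).+1 < 2 ^ r.+1 /\ (2 * b).+1 < 2 ^ r.+1)%N.
  by rewrite expnS; lia.
have cv4 : (fun J => 4 * bad_psum r a b J) @ \oo --> 4 * bad_sum r a b.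
  by apply: cvgMr; exact: cvg_bad_psum.
apply: cvg_unique cv4 => //=.
have -> : (fun J => 4 * bad_psum r a b J) =
    bad_psum r.+1 (2 * a) (2 * b) \+ bad_psum r.+1 (2 * a) (2 * b).+1 \+
    bad_psum r.+1 (2 * a).+1 (2 * b) \+ bad_psum r.+1 (2 * a).+1 (2 * b).+1.
  apply/funext => J; rewrite /= /bad_psum mulr_sumr -!big_split /=.
  apply: eq_bigr => j _; rewrite /bad_frac mulrA -natrM -bad_count_split.
  by rewrite !natrD !mulrDl.
by do 3!(apply: cvgD; last exact: cvg_bad_psum); exact: cvg_bad_psum.
Qed.
End Criterion.

Lemma big_row_bool2 (V : nmodType) (F : 'rV[bool]_2 -> V) :
  let v b c := \row_(j < 2) (if j == 0 then b else c) in
  \sum_a F a =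
  F (v false false) + F (v false true) + F (v true false) + F (v true true).
Proof.
move=> v; rewrite (reindex (fun p : bool * bool => v p.1 p.2)) /=; last first.
  exists (fun a : 'rV[bool]_2 => (a 0 0, a 0 1)) => [[b c] _|a _] /=.
    by rewrite !mxE.
  by apply/rowP => -[[|[|//]] i2]; rewrite !mxE /=; congr (a _ _); exact/val_inj.
rewrite -(pair_bigA _ (fun b c => F (v b c))) /= !big_bool /= addrC.
by rewrite [X in X + _ = _]addrC [X in _ + X = _]addrC addrA.
Qed.

(** * Dyadic cubes and their indices *)

Section Cubes.
Variables (R : realType) (n : nat).
Implicit Types (r : nat) (u : 'rV[int]_n.+1) (x : 'rV[R]_n.+1).

(** If [r < r'], the larger cube contains two points whose coordinates differ by [2 ^- r'], and no
    half-open interval of that length contains both coordinates. *)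
Lemma dyadic_cube_sub r r' u u' :
  dyadic_cube (R:=R) r u `<=` dyadic_cube (R:=R) r' u' -> (r' <= r)%N.
Proof.
move=> sub; rewrite leqNgt; apply/negP => rr'.
pose c t : 'rV[R]_n.+1 := \row_i ((u 0 i)%:~R * 2 ^- r + t).
have cin t : 0 <= t < 2 ^- r -> dyadic_cube (R:=R) r u (c t).
  move=> /andP[t0 tr] i; rewrite mxE lerDl t0 intrD mulrDl mul1r.
  by rewrite ltrD2l.
have p0 k : 0 < 2 ^- k :> R by rewrite invr_gt0 exprn_gt0.
have /sub/(_ ord0) : dyadic_cube (R:=R) r u (c 0) by apply: cin; rewrite lexx p0.
have /sub/(_ ord0) : dyadic_cube (R:=R) r u (c (2 ^- r')).
  apply: cin; rewrite ltW //= ltf_pV2 ?posrE ?exprn_gt0 //.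
  by rewrite ltr_eXn2l ?ltr1n.
rewrite !mxE intrD mulrDl mul1r addr0 => /andP[_ h1] /andP[h2 _].
move: h1; rewrite ltrD2r => /(le_lt_trans h2).
by rewrite ltxx.
Qed.

(** A martingale is a function of sets, so the index has to be recovered from the cube. The
    dimension is positive because in dimension 0 all cubes coincide. *)
Lemma dyadic_cube_inj r r' u u' :
  dyadic_cube (R:=R) r u = dyadic_cube (R:=R) r' u' -> r = r' /\ u = u'.
Proof.
move=> eqQ; have rr' : r = r'.
  apply/eqP; rewrite eqn_leq; apply/andP; split.
    by apply: (@dyadic_cube_sub r' r u' u); rewrite eqQ.
  by apply: (@dyadic_cube_sub r r' u u'); rewrite eqQ.
split=> //; subst r'.
have le (v v' : 'rV[int]_n.+1) : dyadic_cube (R:=R) r v `<=` dyadic_cube (R:=R) r v' ->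
    forall i, v' 0 i <= v 0 i.
  pose c : 'rV[R]_n.+1 := \row_i ((v 0 i)%:~R * 2 ^- r).
  move=> sub i; have /sub/(_ i) : dyadic_cube (R:=R) r v c.
    move=> k; rewrite mxE lexx ltr_pM2r ?invr_gt0 ?exprn_gt0 // ltr_int.
    by rewrite ltrDl.
  by rewrite mxE ler_pM2r ?invr_gt0 ?exprn_gt0 // ler_int => /andP[].
apply/rowP => i; apply/eqP; rewrite eq_le.
by apply/andP; split; apply: le; rewrite eqQ.
Qed.

Lemma dyadic_cube_exists r x : unit_cube x ->
  exists2 u, in_J r u & dyadic_cube (R:=R) r u x.
Proof.
move=> x01; exists (\row_i Num.floor (x 0 i * 2 ^+ r)) => i; rewrite mxE.
  have /andP[x0 x1] := x01 i.
  rewrite floor_ge0 mulr_ge0 ?exprn_ge0 // floor_lt_int.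
  by rewrite rmorphXn /= gtr_pMl ?exprn_gt0.
rewrite ler_pdivrMr ?exprn_gt0 // ltr_pdivlMr ?exprn_gt0 //.
exact: floor_itv.
Qed.

Lemma cube_ofP r x : unit_cube x ->
  exists u, [/\ in_J r u, cube_of r x = dyadic_cube (R:=R) r u & dyadic_cube (R:=R) r u x].
Proof.
move=> /(dyadic_cube_exists r)[u uJ xu].
have [[v vJ vQ] Qx] : [set Q | dyadic_cubes r Q /\ Q x] (cube_of r x).
  by apply: (@xgetI _ _ _ (dyadic_cube (R:=R) r u)); split=> //; exists u.
by exists v; split; rewrite // vQ.
Qed.
End Cubes.

Lemma dyadic_interval_div (R : realFieldType) (t : R) (N r a b : nat) : (N <= r)%N ->
  a%:R * 2 ^- r <= t < a.+1%:R * 2 ^- r ->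
  b%:R * 2 ^- N <= t < b.+1%:R * 2 ^- N -> (a %/ 2 ^ (r - N))%N = b.
Proof.
move=> Nr /andP[a1 a2] /andP[b1 b2].
have E c : c%:R * 2 ^- N = (c * 2 ^ (r - N))%:R * 2 ^- r :> R.
  rewrite -{2}(subnKC Nr) natrM natrX exprD invfM -mulrA; congr (_ * _).
  by rewrite [_^-1 * _]mulrC mulrA divff ?mul1r // expf_neq0.
have p0 : 0 < 2 ^- r :> R by rewrite invr_gt0 exprn_gt0.
move: (le_lt_trans b1 a2) (le_lt_trans a1 b2); rewrite !E !ltr_pM2r // !ltr_nat ltnS.
move=> h1 h2; apply/eqP; rewrite eqn_leq leq_divRL ?expn_gt0 // h1 andbT.
by rewrite -ltnS ltn_divLR ?expn_gt0.
Qed.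

(** * Computability and success of the martingale *)

Section Martingale.
Variables (R : realType) (bad : nat -> nat -> nat -> bool) (N : nat -> nat).
Hypothesis bad_rec : recfun (fun e => (bad (nth 0 e 0) (nth 0 e 1) (nth 0 e 2) : nat))%N.
Hypothesis N_rec : recfun (fun e => N (nth 0 e 0))%N.
Hypothesis bad_small : forall j,
  ((\sum_(i < 2 ^ N j) \sum_(i' < 2 ^ N j) (bad j i i' : nat)) * 2 ^ j
     <= 4 ^ N j)%N.

Definition bad_martingale (Q : set 'rV[R]_2) : R :=
  let ru := xget (0%N, 0) [set ru : nat * 'rV[int]_2 | Q = dyadic_cube (R:=R) ru.1 ru.2] in
  bad_sum bad N R ru.1 (absz (ru.2 0%R 0%R)) (absz (ru.2 0%R 1%R)).

Lemma bad_martingaleE r (u : 'rV[int]_2) :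
  bad_martingale (dyadic_cube (R:=R) r u) =
  bad_sum bad N R r (absz (u 0%R 0%R)) (absz (u 0%R 1%R)).
Proof.
rewrite /bad_martingale; case: xgetP => [[r' u'] _ /= /dyadic_cube_inj[<- <-] //|].
by move=> /(_ (r, u)) /(_ erefl).
Qed.

Lemma in_J_absz n r (u : 'rV[int]_n) i : in_J r u -> (absz (u 0%R i) < 2 ^ r)%N.
Proof.
move=> /(_ i)/andP[u0 ur]; rewrite -ltz_nat gez0_abs //.
by rewrite -[X in _ < X]natz natrX.
Qed.

Lemma martingale_bad : martingale bad_martingale.
Proof.
split=> [r _ [u uJ <-]|r u uJ].
  by rewrite bad_martingaleE bad_sum_ge0 ?in_J_absz.
rewrite big_row_bool2 /= !bad_martingaleE !mxE /=.
have E i (b : nat) : (`|(u 0 i *+ 2 + b%:Z)%R| = 2 * absz (u 0%R i) + b)%N.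
  by have /andP[u0 _] := uJ i; lia.
rewrite !E !addn0 !addn1 bad_sum_split ?in_J_absz //.
by rewrite -natrX mulKf ?pnatr_eq0.
Qed.

Lemma recfun_bad_count : recfun (fun e => bad_count bad N
  (nth 0 e 0) (nth 0 e 1) (nth 0 e 2) (nth 0 e 3))%N.
Proof.
have rN a : recfun a -> recfun (fun e => N (a e)) by exact: recfun_call1.
rewrite /bad_count.
apply: recfun_sum.
  by apply: recfun_pow (recfun_const 2) (rN _ _); recfun_tac.
apply: recfun_sum.
  by apply: recfun_pow (recfun_const 2) (rN _ _); recfun_tac.
apply: (recfun_call3 (f := fun a b c => bad a b c : nat) bad_rec); recfun_tac.
  by apply: rN; recfun_tac.
by apply: rN; recfun_tac.
Qed.

(** [4 ^ S J] is a common denominator of the first [J] terms. With [J = s + 2 r + 1] terms the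
    neglected tail is at most [2 * 4 ^ r * 2 ^- J = 2 ^- s]. *)
Let S J := (\sum_(0 <= j < J) N j)%N.
Let num s r a b := (\sum_(0 <= j < s + 2 * r + 1)
  bad_count bad N j r a b * 4 ^ (S (s + 2 * r + 1) - N j))%N.
Let den s r := (4 ^ S (s + 2 * r + 1))%N.

Let leNS J j : (j < J)%N -> (N j <= S J)%N.
Proof. by move=> jJ; rewrite /S big_mkord (bigD1 (Ordinal jJ)) //= leq_addr. Qed.

Lemma computable_bad_martingale : computable_martingale bad_martingale.
Proof.
split; first exact: martingale_bad.
exists (fun s r u => (num s r (absz (u 0%R 0%R)) (absz (u 0%R 1%R)))%:R / (den s r)%:R); split.
  exists (fun x => num (nth 0 x 0) (nth 0 x 1) (nth 0 x 2) (nth 0 x 3))%N.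
  exists (fun x => den (nth 0 x 0) (nth 0 x 1))%N.
  have rS a : recfun a -> recfun (fun e => S (a e)).
    apply: (@recfun_call1 S); apply: (recfun_sum (F := fun i e => N i)).
      exact: recfun_nth.
    exact: N_rec.
  split.
  - suff : recfun (fun x => num (nth 0 x 0) (nth 0 x 1) (nth 0 x 2) (nth 0 x 3))%N.
      exact.
    rewrite /num; apply: recfun_sum; first by recfun_tac.
    apply: recfun_mul; first by apply: (recfun_call4 recfun_bad_count); recfun_tac.
    apply: recfun_pow; first by recfun_tac.
    apply: recfun_sub; first by apply: rS; recfun_tac.
    exact: N_rec.
  - suff : recfun (fun x => den (nth 0 x 0) (nth 0 x 1))%N by exact.
    by apply: recfun_pow; [recfun_tac | apply: rS; recfun_tac].
  - move=> s r u uJ; rewrite /= /den expn_gt0 /=.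
    by rewrite enum_ordSl /= enum_ordSl /= (_ : lift _ _ = 1) //; apply/val_inj.
move=> s r u uJ; rewrite bad_martingaleE.
have [a2 b2] := (in_J_absz 0 uJ, in_J_absz 1 uJ).
set a := absz (u 0%R 0%R) in a2 *.
set b := absz (u 0%R 1%R) in b2 *; set J := (s + 2 * r + 1)%N.
have -> : ratr ((num s r a b)%:R / (den s r)%:R) = bad_psum bad N R r a b J.
  rewrite fmorph_div !rmorph_nat /num /den -/J big_mkord natr_sum mulr_suml.
  apply: eq_bigr => j _; rewrite /bad_frac natrM !natrX -mulrA; congr (_ * _).
  by rewrite -[in X in _ / X](subnK (leNS (ltn_ord j))) exprD invfM mulrA divff
    ?mul1r // expf_neq0.
have h1 := bad_psum_le_sum R bad_small J a2 b2.
have h2 := bad_sum_le_psum R bad_small J a2 b2.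
rewrite ler_norml; apply/andP; split; last first.
  apply: le_trans (_ : 0 <= _); first by rewrite subr_le0.
  by rewrite invr_ge0 exprn_ge0.
rewrite lerNl opprB lerBlDl (le_trans h2) // lerD2l /J.
rewrite (natrX _ 2 2) -exprM -exprS -addnA exprD invfM mulrCA addn1 divff ?mulr1 //.
Qed.

Lemma bad_martingale_succeeds x : unit_cube x ->
  (exists j0, forall j u, (j0 <= j)%N -> in_J (N j) u ->
     dyadic_cube (R:=R) (N j) u x -> bad j (absz (u 0%R 0%R)) (absz (u 0%R 1%R))) ->
  succeeds_at bad_martingale x.
Proof.
move=> x01 [j0 bad_x].
(* From level [S J] on, the cube of [x] is at least as fine as the grids of all stages [j < J], so
   each of these stages from [j0] on contributes exactly 1. *)
have main J r : (S J <= r)%N -> (J - j0)%:R <= bad_martingale (cube_of r x).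
  move=> SJr; have [u [uJ -> xu]] := cube_ofP r x01.
  rewrite bad_martingaleE; apply: le_trans (bad_psum_le_sum R bad_small J _ _);
    rewrite ?in_J_absz //.
  have -> : (J - j0)%:R = \sum_(j < J) (if (j0 <= j)%N then 1 else 0) :> R.
    elim: J {SJr} => [|J IH]; first by rewrite big_ord0.
    rewrite big_ord_recr /= -IH; case: leqP => h.
      by rewrite subSn // -addn1 natrD.
    by rewrite addr0; congr _%:R; lia.
  apply: ler_sum => j _; case: leqP => [j0j|_]; last exact: bad_frac_ge0.
  have Njr : (N j <= r)%N := leq_trans (leNS (ltn_ord j)) SJr.
  have [v vJ xv] := dyadic_cube_exists (N j) x01.
  have E i : (absz (u 0%R i) %/ 2 ^ (r - N j))%N = (absz (v 0%R i)).
    have cst r' (w : 'rV[int]_2) : in_J r' w -> dyadic_cube (R:=R) r' w x ->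
      (absz (w 0%R i))%:R * 2 ^- r' <= x 0 i < (absz (w 0%R i)).+1%:R * 2 ^- r'.
      move=> /(_ i)/andP[w0 _] /(_ i); have := gez0_abs w0.
      by move: (absz _) => c <-; rewrite intrD -pmulrn natr1.
    exact: dyadic_interval_div (cst _ _ uJ xu) (cst _ _ vJ xv).
  rewrite /bad_frac bad_count_full ?E ?bad_x // natrX divff //.
rewrite /succeeds_at.
have cvgy : (bad_martingale (cube_of r x))%:E @[r --> \oo] --> +oo%E.
  apply/cvgeyPge => A; near=> r; rewrite lee_fin.
  pose J := (Num.truncn A).+1 + j0.
  have /main : (S (J)%N <= r)%N by near: r; exact: nbhs_infty_ge.
  apply: le_trans; rewrite /J addnK ltW //.
  exact: truncnS_gt.
rewrite is_cvg_limn_esupE; last exact: cvgP cvgy.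
exact: cvg_lim cvgy.
Unshelve. all: by end_near. Qed.
End Martingale.

(** An effective Borel-Cantelli argument: the bad squares of stage [j] have proportion at most
    [2 ^- j], so the relative measures have a finite sum on every cube, and this sum is unbounded
    along a point that lies in bad squares of all large stages. *)
Lemma computable_measure0_criterion (R : realType)
  (bad : nat -> nat -> nat -> bool) (N : nat -> nat) (E : set 'rV[R]_2) :
  recfun (fun e => (bad (nth 0 e 0) (nth 0 e 1) (nth 0 e 2) : nat))%N ->
  recfun (fun e => N (nth 0 e 0))%N ->
  (forall j, (\sum_(i < 2 ^ N j) \sum_(i' < 2 ^ N j) (bad j i i' : nat)) * 2 ^ j
     <= 4 ^ N j)%N ->
  (forall x, periodize E x -> exists j0, forall j u, (j0 <= j)%N ->
     in_J (N j) u -> dyadic_cube (R:=R) (N j) u x ->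
     bad j (absz (u 0%R 0%R)) (absz (u 0%R 1%R))) ->
  computable_measure0 E.
Proof.
move=> rbad rN small cov; exists (@bad_martingale R bad N); split.
  exact: computable_bad_martingale.
by move=> x Ex; apply: bad_martingale_succeeds (cov x Ex) => //; case: Ex.
Qed.

(** * Near coincidences of strips *)

(** Base 4 with the leading digit first. For the identity and for [digit_shift] this is [4 ^ size w]
    times a coordinate of the lower left corner of [F_word w]. *)
Fixpoint word_num (d : 'I_4 -> nat) (w : seq 'I_4) : nat :=
  if w is i :: w' then (d i * 4 ^ size w' + word_num d w')%N else 0%N.

Lemma word_num_cat d v w :
  word_num d (v ++ w) = (word_num d v * 4 ^ size w + word_num d w)%N.
Proof.
elim: v => //= i v ->; rewrite size_cat expnD; lia.
Qed.

Lemma word_num_rcons d w i : word_num d (rcons w i) = (4 * word_num d w + d i)%N.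
Proof. by rewrite -cats1 word_num_cat /= expn1 expn0; lia. Qed.

Lemma word_num_lt d w : (forall i, d i < 4)%N -> (word_num d w < 4 ^ size w)%N.
Proof.
move=> d4; elim: w => //= i w IH; rewrite expnS.
apply: leq_trans (_ : d i * 4 ^ size w + 4 ^ size w <= _)%N.
  by rewrite -addnS leq_add2l.
by rewrite -mulSnr leq_mul2r d4 orbT.
Qed.

Lemma digit_shift_lt i : (digit_shift i < 4)%N.
Proof. by case: i => [[|[|[|[|]]]]]. Qed.

Section WordValue.
Variable R : realType.
Implicit Types (x : R) (v w : seq 'I_4).

(* The vertical section of the strip [lines_of (F_word w)] over [x], scaled by
   [4 ^ size w], starts at [word_val x w]. *)
Definition word_val x w : R :=
  (word_num (@nat_of_ord 4) w)%:R * x + (word_num digit_shift w)%:R.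

Lemma word_val_cat x v w :
  word_val x (v ++ w) = word_val x v * 4 ^+ size w + word_val x w.
Proof. by rewrite /word_val !word_num_cat !natrD !natrM natrX; ring. Qed.

Lemma word_val_le x w : `|word_val x w| <= (`|x| + 1) * 4 ^+ size w.
Proof.
have le d : (forall i, d i < 4)%N -> (word_num d w)%:R <= 4 ^+ size w :> R.
  by move=> d4; rewrite -natrX ler_nat ltnW // word_num_lt.
apply: le_trans (ler_normD _ _) _; rewrite normrM !normr_nat mulrDl mul1r.
rewrite lerD //; last exact/le/digit_shift_lt.
by rewrite mulrC ler_wpM2l // le.
Qed.

Lemma word_val_lip x x' w :
  `|word_val x w - word_val x' w| <= 4 ^+ size w * `|x - x'|.
Proof.
have -> : word_val x w - word_val x' w = (word_num (@nat_of_ord 4) w)%:R * (x - x').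
  by rewrite /word_val; ring.
rewrite normrM normr_nat ler_wpM2r // -natrX ler_nat ltnW //.
exact: word_num_lt.
Qed.
End WordValue.

(** Integers with [k] base-4 digits in [{-1, 0, 1}], that is, differences of numbers whose base-4
    digits are bits. *)
Inductive ternary : nat -> int -> Prop :=
| ternary0 : ternary 0 0
| ternaryS k P p : ternary k P -> `|p| <= 1 -> ternary k.+1 (4 * P + p).

Lemma ternaryN k P : ternary k P -> ternary k (- P).
Proof.
elim=> [|{}k {}P p _ IH p1]; first by rewrite oppr0; exact: ternary0.
have -> : - (4 * P + p) = 4 * (- P) + (- p) by lia.
by apply: ternaryS; rewrite ?normrN.
Qed.

Lemma ternary_widen m k P : ternary k P -> ternary (m + k) P.
Proof.
elim: m => // m IH /IH {IH}; rewrite addSn.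
elim=> [|{}k {}P p _ IH p1]; last exact: ternaryS.
by have := ternaryS ternary0 (p := 0); rewrite mulr0 addr0; apply.
Qed.

Lemma ternary_scale m k P : ternary k P -> ternary (m + k) (4 ^+ m * P).
Proof.
elim: m => [|m IH] tP; first by rewrite expr0 mul1r.
have -> : 4 ^+ m.+1 * P = 4 * (4 ^+ m * P) + 0 by rewrite exprS mulrA addr0.
by apply: ternaryS => //; exact: IH.
Qed.

(* The vectors [(i, digit_shift i)] are [(0, 2) + e (1, -2) + f (2, 1)] with
   [i = e + 2 f] for bits [e] and [f]. *)
Lemma ternary_words k P Q : ternary k P -> ternary k Q -> exists v w,
  [/\ size v = k, size w = k,
      (word_num (@nat_of_ord 4) v)%:Z - (word_num (@nat_of_ord 4) w)%:Z = P + 2 * Q &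
      (word_num digit_shift v)%:Z - (word_num digit_shift w)%:Z = Q - 2 * P].
Proof.
move=> tP; elim: tP Q => [|{}k {}P p _ IH p1] Q tQ.
  by exists [::], [::]; split => //; inversion tQ.
inversion tQ as [|k' Q' q tQ' q1 [kk] QE]; subst k'.
have [v [w [sv sw hM hB]]] := IH _ tQ'.
suff [i [j [hi hj]]] : exists i j : 'I_4, (nat_of_ord i)%:Z - (nat_of_ord j)%:Z = p + 2 * q
    /\ (digit_shift i)%:Z - (digit_shift j)%:Z = q - 2 * p.
  exists (rcons v i), (rcons w j); rewrite !size_rcons sv sw !word_num_rcons.
  by split => //; lia.
have o k0 : (k0 < 4)%N -> exists i : 'I_4, nat_of_ord i = k0 by move=> h; exists (Ordinal h).
have ds (i : 'I_4) n : nat_of_ord i = n -> digit_shift i = nth 0%N [:: 2; 0; 3; 1]%N n.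
  by move=> <-.
have [i0 e0] := o 0%N isT; have [i1 e1] := o 1%N isT.
have [i2 e2] := o 2%N isT; have [i3 e3] := o 3%N isT.
have := (ds _ _ e0, ds _ _ e1, ds _ _ e2, ds _ _ e3) => /= -[[[d0 d1] d2] d3].
have [pN|pN] : p = -1 \/ (p = 0 \/ p = 1) by lia.
  have [qN|[qN|qN]] : q = -1 \/ (q = 0 \/ q = 1) by lia.
  - by exists i0, i3; rewrite e0 e3 d0 d3; lia.
  - by exists i0, i1; rewrite e0 e1 d0 d1; lia.
  - by exists i2, i1; rewrite e2 e1 d2 d1; lia.
have [qN|[qN|qN]] : q = -1 \/ (q = 0 \/ q = 1) by lia.
- by case: pN => pN; [exists i0, i2; rewrite e0 e2 d0 d2; lia |
    exists i1, i2; rewrite e1 e2 d1 d2; lia].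
- by case: pN => pN; [exists i0, i0; rewrite e0 d0; lia |
    exists i1, i0; rewrite e1 e0 d1 d0; lia].
- by case: pN => pN; [exists i2, i0; rewrite e2 e0 d2 d0; lia |
    exists i3, i0; rewrite e3 e0 d3 d0; lia].
Qed.

(** * Bounded combinations with large coefficients *)

Section Steering.
Variable R : realType.
Implicit Types a b s : R.

(** The intervals of radius [(a + b) / 3] around [0], [a], [b] and [a + b] cover
    [[0, 4 (a + b) / 3]], because consecutive centers differ by at most [2 (a + b) / 3]; negative
    [s] follows by symmetry. *)
Lemma steer_step a b s : 0 < a -> a <= b -> b <= 4 * a -> `|s| <= (a + b) / 3 ->
  exists p q : int, [/\ `|p| <= 1, `|q| <= 1 &
    `|4 * s + p%:~R * a + q%:~R * b| <= (a + b) / 3].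
Proof.
move=> a0 ab ba.
wlog s0 : s / 0 <= s => [hw|].
  have [/hw//|s0] := leP 0 s; rewrite -normrN => hs.
  have [|p [q [hp hq h]]] := hw (- s) _ hs; first by rewrite oppr_ge0 ltW.
  exists (- p), (- q); rewrite !normrN; split => //.
  by rewrite -normrN !intrN; apply: le_trans h; rewrite le_eqVlt; apply/orP; left;
    apply/eqP; congr `|_|; ring.
rewrite ger0_norm // => sc.
have [h1|h1] := leP (4 * s) ((a + b) / 3).
  by exists 0, 0; split=> //; rewrite !mul0r !addr0 ler_norml; apply/andP; split; lra.
have [h2|h2] := leP (4 * s) (a + (a + b) / 3).
  exists (-1), 0; split=> //; rewrite mul0r addr0 ler_norml; apply/andP; split; lra.
have [h3|h3] := leP (4 * s) (b + (a + b) / 3).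
  exists 0, (-1); split=> //; rewrite mul0r addr0 ler_norml; apply/andP; split; lra.
exists (-1), (-1); split=> //; rewrite ler_norml; apply/andP; split; lra.
Qed.

Lemma steer_pos a b n : 0 < a -> a <= b -> b <= 4 * a ->
  exists k P Q, [/\ ternary k P, ternary k Q,
    `|P%:~R * a + Q%:~R * b| <= (a + b) / 3, n%:Z < `|P| & n%:Z < `|Q|].
Proof.
move=> a0 ab ba; elim: n => [|n [k [P [Q [tP tQ h nP nQ]]]]].
  (* The starting coefficients are [(-1, 1)] for [b <= 2 a] and [(-3, 1)] for larger [b]; two digits
     suffice. Each later step replaces a nonzero [P] by [4 P + p], which is larger in absolute
     value, and likewise for [Q]. *)
  have t1 : ternary 2 1 by rewrite -[1]/(4 * (4 * 0 + 0) + 1 : int); do !constructor.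
  have tN1 : ternary 2 (-1) by exact: ternaryN.
  have t3 : ternary 2 (-3) by rewrite -[-3]/(4 * (4 * 0 + -1) + 1 : int); do !constructor.
  have [b2|b2] := leP b (2 * a).
    by exists 2%N, (-1), 1; split=> //; rewrite ler_norml; apply/andP; split; lra.
  by exists 2%N, (-3), 1; split=> //; rewrite ler_norml; apply/andP; split; lra.
have [p [q [p1 q1 h']]] := steer_step a0 ab ba h.
exists k.+1, (4 * P + p), (4 * Q + q).
split; [exact: ternaryS | exact: ternaryS | | lia | lia].
apply: le_trans h'; rewrite le_eqVlt; apply/orP; left; apply/eqP; congr `|_|.
by rewrite !intrD !intrM; ring.
Qed.

(** Signs are absorbed in [P] and [Q], and [a] is first multiplied by the power of 4 that brings it
    within a factor 4 of [b]; in [P] this power appends zero digits. *)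
Lemma steer_le (a b : R) : a != 0 -> `|a| <= `|b| -> exists c : R, forall n,
  exists k P Q, [/\ ternary k P, ternary k Q,
    `|P%:~R * a + Q%:~R * b| <= c, n%:Z < `|P| & n%:Z < `|Q|].
Proof.
move=> a0 ab; have a_gt0 : 0 < `|a| by rewrite normr_gt0.
have [m hm] : exists m, 4 ^+ m * `|a| <= `|b| < 4 * (4 ^+ m * `|a|).
  have ex : exists m, `|b| < 4 ^+ m.+1 * `|a|.
    have [m hm] : exists m : nat, `|b| / `|a| < m%:R.
      by exists (Num.truncn (`|b| / `|a|)).+1; exact: truncnS_gt.
    exists m; rewrite -ltr_pdivrMr //; apply: lt_le_trans hm _.
    by rewrite -natrX ler_nat ltnW // (leq_trans (ltn_expl m (isT : 1 < 4)%N)) // leq_exp2l.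
  have [m hm m_min] := ex_minnP ex; exists m; rewrite mulrA -exprS hm andbT.
  case: m hm m_min => [|m] _ m_min; first by rewrite mul1r.
  by rewrite leNgt; apply/negP => /m_min; rewrite ltnn.
exists ((4 ^+ m * `|a| + `|b|) / 3) => n.
case/andP: hm => h1 /ltW h2.
have [|k [P [Q [tP tQ h nP nQ]]]] := steer_pos n _ h1 h2.
  by rewrite mulr_gt0 ?exprn_gt0.
have sgn (c : R) : exists2 s : int, (s = 1 \/ s = -1) & s%:~R * c = `|c|.
  have [c0|c0] := leP 0 c; [exists 1|exists (-1)]; [by left| |by right|].
    by rewrite mul1r ger0_norm.
  by rewrite mulrN1z mulN1r ltr0_norm.
have [sa sa1 saE] := sgn a; have [sb sb1 sbE] := sgn b.
exists (m + k)%N, (4 ^+ m * (sa * P)), (sb * Q); split.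
- by apply: ternary_scale; case: sa1 => ->; rewrite ?mul1r ?mulN1r //; exact: ternaryN.
- by apply: ternary_widen; case: sb1 => ->; rewrite ?mul1r ?mulN1r //; exact: ternaryN.
- apply: le_trans h; rewrite -saE -sbE le_eqVlt; apply/orP; left; apply/eqP; congr `|_|.
  by rewrite !intrM rmorphXn /=; ring.
- have : (1 <= 4 ^+ m :> int) by rewrite exprn_ege1.
  by case: sa1 => ->; nia.
- by case: sb1 => ->; lia.
Qed.

(* The word differences are [P (x - 2) + Q (2 x + 1)] with [P], [Q] ternary. *)
Lemma bounded_differences (x : R) : x != 2 -> x != - 2^-1 -> exists c : R, forall n : nat,
  exists v w, [/\ size v = size w, `|word_val x v - word_val x w| <= c &
    n%:R < `|(word_num (@nat_of_ord 4) v)%:R - (word_num (@nat_of_ord 4) w)%:R : R|].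
Proof.
move=> x2 xN.
have a0 : x - 2 != 0 by rewrite subr_eq0.
have b0 : 2 * x + 1 != 0 by apply: contra xN => /eqP h; apply/eqP; lra.
have [c hc] : exists c : R, forall n, exists k P Q, [/\ ternary k P, ternary k Q,
    `|P%:~R * (x - 2) + Q%:~R * (2 * x + 1)| <= c & n%:Z < `|Q|].
  have [/(steer_le a0)|/ltW/(steer_le b0)] := leP `|x - 2| `|2 * x + 1|;
    case=> c hc; exists c => n; have [k [P [Q [tP tQ h nP nQ]]]] := hc n.
    by exists k, P, Q.
  by exists k, Q, P; split => //; rewrite addrC.
exists c => n.
(* The slope is [P + 2 Q], and [(P + 2 Q) (x - 2) = s - 5 Q] where [s] is the difference bounded by
   [c]. Hence [|Q| > n'] forces the slope above [n] in absolute value. *)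
have [n' hn'] : exists n' : nat, (n%:R * `|x - 2| + c) / 5 < n'%:R.
  by exists (Num.truncn ((n%:R * `|x - 2| + c) / 5)).+1; exact: truncnS_gt.
have [k [P [Q [tP tQ h nQ]]]] := hc n'.
have [v [w [sv sw hM hB]]] := ternary_words tP tQ.
have hMR : (word_num (@nat_of_ord 4) v)%:R - (word_num (@nat_of_ord 4) w)%:R =
  (P + 2 * Q)%:~R :> R by rewrite -hM intrB -!pmulrn.
have hBR : (word_num digit_shift v)%:R - (word_num digit_shift w)%:R =
  (Q - 2 * P)%:~R :> R by rewrite -hB intrB -!pmulrn.
exists v, w; rewrite sv sw hMR; split=> //.
  apply: le_trans h; rewrite le_eqVlt; apply/orP; left; apply/eqP; congr `|_|.
  have -> : word_val x v - word_val x w = (P + 2 * Q)%:~R * x + (Q - 2 * P)%:~R.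
    by rewrite -hMR -hBR /word_val; ring.
  by rewrite intrB intrD !intrM; ring.
set s := P%:~R * (x - 2) + Q%:~R * (2 * x + 1) in h.
have E : (P + 2 * Q)%:~R * (x - 2) = s - 5 * Q%:~R.
  by rewrite /s intrD intrM; ring.
have nQR : n'%:R < `|Q%:~R| :> R.
  by rewrite -intr_norm -[n'%:R]/(n'%:Z%:~R) ltr_int.
have a_gt0 : 0 < `|x - 2| by rewrite normr_gt0.
rewrite -(ltr_pM2r a_gt0) -normrM E.
have := ler_distD s (5 * Q%:~R) 0; rewrite !subr0 distrC normrM (ger0_norm (_ : 0 <= 5)) //.
move: nQR hn' h; rewrite ltr_pdivrMr //; lra.
Qed.
End Steering.

(** * Near coincidences at almost every abscissa *)

Section Coincidence.
Variable R : realType.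
Local Notation mu := (@lebesgue_measure R).

Definition near_coincidence (e : R) : set R := [set x | exists v w,
  [/\ size v = size w, v <> w & `|word_val x v - word_val x w| < e]].

Lemma continuous_word_val w : continuous ((@word_val R)^~ w).
Proof.
move=> x; apply: cvgD; last exact: cvg_cst.
by apply: cvgMr; exact: cvg_id.
Qed.

Lemma open_near_coincidence e : open (near_coincidence e).
Proof.
have -> : near_coincidence e = \bigcup_(vw in
    [set vw : seq 'I_4 * seq 'I_4 | size vw.1 = size vw.2 /\ vw.1 <> vw.2])
    ((fun x => `|word_val x vw.1 - word_val x vw.2|) @^-1` [set y | y < e]).
  apply/seteqP; split => [x [v [w [s n h]]]|x [[v w] [s n] h]].
    by exists (v, w).
  by exists v, w.
apply: bigcup_open => -[v w] _; apply: open_comp; last exact: open_lt.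
by move=> x _; apply: cvg_norm; apply: cvgB; exact: continuous_word_val.
Qed.

(* Near the zero of [word_val x v - word_val x w] there is an interval of near
   coincidences; it fills a fixed proportion of a ball around [x] that shrinks
   as the slope of the difference grows. *)
Lemma negligible_no_near_coincidence e : 0 < e ->
  mu.-negligible (~` near_coincidence e).
Proof.
move=> e0; set Z := ~` near_coincidence e.
have mZ : measurable Z.
  by apply: measurableC; apply: open_measurable; exact: open_near_coincidence.
have /= := lebesgue_density mZ; rewrite /almost_everywhere /= => nD.
have neg1 (t : R) : mu.-negligible [set t].
  by exists [set t]; split => //; exact: lebesgue_measure_set1.
apply: negligibleS (negligibleU (negligibleU nD (neg1 2)) (neg1 (- 2^-1))).
move=> x Zx; have [->|x2] := eqVneq x 2; first by left; right.
have [->|xN] := eqVneq x (- 2^-1); first by right.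
left; left => /= cv.
have [c hc] := bounded_differences x2 xN.
have c0 : 0 <= c.
  by have [v [w [_ h _]]] := hc 0%N; exact: le_trans (normr_ge0 _) h.
have ce0 : 0 < c + e by rewrite ltr_wpDl.
move: cv; rewrite indicE mem_set // => cv.
(* [e / (c + e)] is the ratio [rho / r] of the radii below, so density of [Z] above [th] in
   [ball x r] leaves no room for the ball of near coincidences. *)
pose th := 1 - e / (c + e) : R.
have thlt1 : (th%:E < 1%:E)%E by rewrite lte_fin gtrBl divr_gt0.
have hn : \forall r \near 0^'+,
  (th%:E < mu (Z `&` ball x r) * (mu (ball x r))^-1)%E := cv _ (open_ereal_gt' thlt1).
case: hn => d /= d0 hd.
have [n hn] : exists n : nat, (c + e) / d < n%:R.
  by exists (Num.truncn ((c + e) / d)).+1; exact: truncnS_gt.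
have [v [w [svw Dc nM]]] := hc n.
set D := word_val x v - word_val x w in Dc.
set M := _ - _ in nM.
have M0 : 0 < `|M| by apply: le_lt_trans nM.
have DE y : word_val y v - word_val y w = D + M * (y - x).
  by rewrite /D /M /word_val; ring.
(* [y0] is the zero of the difference, which is affine of slope [M]. Its distance to [x] is at most
   [c / |M|], so the ball of radius [rho] around it lies in [ball x r]. *)
pose r := (c + e) / `|M|; pose y0 := x - D / M; pose rho := e / `|M|.
have r0 : 0 < r by rewrite divr_gt0.
have rho0 : 0 < rho by rewrite divr_gt0.
have rd : r < d.
  rewrite ltr_pdivrMr // mulrC -ltr_pdivrMr //; exact: lt_trans hn nM.
have {hd} := hd r; rewrite /= sub0r normrN gtr0_norm // => /(_ rd r0).
have Mn0 : M != 0 by rewrite -normr_gt0.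
have sub1 : ball y0 rho `<=` near_coincidence e.
  move=> y; rewrite /ball /= => hy; exists v, w; split => //.
    by move=> vw; move: Mn0; rewrite /M vw subrr eqxx.
  rewrite DE; have -> : D + M * (y - x) = M * (y - y0) by rewrite /y0; field.
  by rewrite normrM mulrC -ltr_pdivlMr // distrC.
have sub2 : ball y0 rho `<=` ball x r.
  move=> y; rewrite /ball /= => hy; rewrite -(subrK y0 x) -addrA.
  apply: le_lt_trans (ler_normD _ _) _.
  have -> : x - y0 = D / M by rewrite /y0; ring.
  rewrite /r [ltRHS]mulrDl; apply: ler_ltD => //.
  by rewrite normf_div ler_pM2r ?invr_gt0.
have le_mu : (mu (Z `&` ball x r) + mu (ball y0 rho) <= mu (ball x r))%E.
  rewrite -measureU; [| by apply: measurableI => //; exact: measurable_ball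
    | exact: measurable_ball |].
  - apply: le_measure; rewrite ?inE.
    + apply: measurableU; last exact: measurable_ball.
      by apply: measurableI => //; exact: measurable_ball.
    + exact: measurable_ball.
    + by move=> y [[]|/sub2].
  - by rewrite -subset0 => y [[Zy _] /sub1].
move: le_mu; rewrite (lebesgue_measure_ball _ (ltW r0)) (lebesgue_measure_ball _ (ltW rho0)).
have : (0 <= mu (Z `&` ball x r))%E by [].
rewrite inver mulrn_eq0 /= gt_eqF //.
case: (mu (Z `&` _)) => [m|_|//]; last by rewrite addye // leye_eq.
rewrite -EFinM -EFinD !lee_fin lte_fin => m0 mle.
have r20 : 0 < r *+ 2 by rewrite mulrn_wgt0.
rewrite ltr_pdivlMr //.
have -> : th = 1 - rho / r by rewrite /th /rho /r; field; rewrite !gt_eqF.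
rewrite mulrBl mul1r -[r *+ 2]mulr_natl.
have -> : rho / r * (2 * r) = rho *+ 2.
  by rewrite mulrCA divfK ?gt_eqF // mulr_natl.
rewrite mulr_natl; lra.
Qed.

Definition generic_abscissa : set R := [set x | forall e, 0 < e -> near_coincidence e x].

Lemma negligible_not_generic : mu.-negligible (~` generic_abscissa).
Proof.
have neg : mu.-negligible (\bigcup_n ~` near_coincidence n.+1%:R^-1).
  apply: negligible_bigcup => n; apply: negligible_no_near_coincidence.
  by rewrite invr_gt0.
apply: negligibleS neg.
move=> x nx; apply: contrapT => h; apply: nx => e e0.
have [n hn] : exists n : nat, e^-1 < n.+1%:R.
  by exists (Num.truncn e^-1); exact: truncnS_gt.
have [v [w [s vw lt]]] : near_coincidence n.+1%:R^-1 x.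
  by apply: contrapT => nc; apply: h; exists n.
exists v, w; split=> //; apply: lt_trans lt _.
by rewrite -[ltRHS]invrK ltf_pV2 // posrE ?invr_gt0.
Qed.
End Coincidence.

(** * Covering the strips efficiently *)

Definition words (k : nat) : seq (seq 'I_4) := [seq tval t | t <- enum {: k.-tuple 'I_4}].

Lemma mem_words k w : (w \in words k) = (size w == k).
Proof.
apply/mapP/eqP => [[t _ ->]|sw]; first exact: size_tuple.
by move/eqP: sw => sw; exists (Tuple sw); rewrite ?mem_enum.
Qed.

Lemma uniq_words k : uniq (words k).
Proof. by rewrite map_inj_uniq ?enum_uniq //; exact: val_inj. Qed.

Lemma size_words k : size (words k) = (4 ^ k)%N.
Proof. by rewrite size_map -cardE card_tuple card_ord. Qed.

Section Covers.
Variable R : realType.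
Implicit Types (x f g : R).

(** The family doubles at each step: its words are extended by two nearly coinciding prefixes [v]
    and [w]. The suffixes of length [k] magnify the difference of the prefixes by [4 ^ k], hence the
    tolerance [e / 2 / 4 ^ k]. *)
Lemma cluster x (l : nat) (e : R) : generic_abscissa x -> 0 < e ->
  exists k us, [/\ uniq us, size us = (2 ^ l)%N, {in us, forall u, size u = k} &
    {in us &, forall u u', `|word_val x u - word_val x u'| < e}].
Proof.
move=> gx; elim: l e => [|l IH] e e0.
  exists 0%N, [:: [::]]; split=> // [u|u u']; rewrite !inE => /eqP -> // /eqP ->.
  by rewrite subrr normr0.
have [k [us [uus sus kus dus]]] := IH _ (divr_gt0 e0 (ltr0n R 2)).
have [v [w [svw vw dvw]]] :=
  gx (e / 2 / 4 ^+ k) (divr_gt0 (divr_gt0 e0 (ltr0n R 2)) (exprn_gt0 _ (ltr0n R 4))).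
exists (size v + k)%N, ([seq v ++ u | u <- us] ++ [seq w ++ u | u <- us]); split.
- rewrite cat_uniq !map_inj_uniq ?uus /=; last 2 first.
    by move=> u u' /eqP; rewrite eqseq_cat // eqxx => /eqP.
    by move=> u u' /eqP; rewrite eqseq_cat // eqxx => /eqP.
  rewrite andbT; apply/hasPn => _ /mapP[u _ ->]; apply/mapP => -[u' _] /eqP.
  by rewrite eqseq_cat // => /andP[/eqP wv _]; apply: vw.
- by rewrite size_cat !size_map sus expnS mul2n addnn.
- by move=> u; rewrite mem_cat => /orP[] /mapP[u' /kus su' ->];
    rewrite size_cat ?svw su'.
have half (d : R) u u' : `|d| < e / 2 / 4 ^+ k -> u \in us -> u' \in us ->
    `|d * 4 ^+ k + (word_val x u - word_val x u')| < e.
  move=> hd hu hu'; apply: le_lt_trans (ler_normD _ _) _.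
  have := dus _ _ hu hu'; rewrite normrM [`|4 ^+ k|]ger0_norm ?exprn_ge0 //.
  by rewrite ltr_pdivlMr ?exprn_gt0 // in hd; move: hd; lra.
have E s s' u u' : u \in us -> u' \in us -> word_val x (s ++ u) - word_val x (s' ++ u') =
    (word_val x s - word_val x s') * 4 ^+ k + (word_val x u - word_val x u').
  by move=> /kus su /kus su'; rewrite !word_val_cat su su'; ring.
have d0 : `|0 : R| < e / 2 / 4 ^+ k by rewrite normr0 !divr_gt0 ?exprn_gt0.
move=> u u'; rewrite !mem_cat => /orP[] /mapP[{}u hu ->] /orP[] /mapP[{}u' hu' ->];
  rewrite E //; apply: half => //; rewrite ?subrr //.
by rewrite distrC.
Qed.

Lemma interval_cover (c : R) (L : nat) : exists2 ys : seq R, size ys = (2 * L).+1 &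
  forall t, `|t - c| <= L%:R -> exists2 y, y \in ys & `|t - y| <= 1.
Proof.
exists [seq c + i%:R - L%:R | i <- iota 0 (2 * L).+1]; first by rewrite size_map size_iota.
move=> t; rewrite ler_norml => /andP[h1 h2].
have t0 : 0 <= t - c + L%:R by lra.
have /andP[i1 i2] := truncn_itv t0; set i := Num.truncn _ in i1 i2.
exists (c + i%:R - L%:R).
  apply/mapP; exists i => //; rewrite mem_iota /= add0n ltnS -(ler_nat R) natrM; lra.
by rewrite -natr1 in i2; rewrite ler_norml; apply/andP; split; lra.
Qed.

Definition covered x (N : nat) f := exists ys : seq R, (size ys)%:R <= f * 4 ^+ N /\
  forall w, size w = N -> exists2 y, y \in ys & `|word_val x w - y| <= 1.

Lemma covered_le x N f g : f <= g -> covered x N f -> covered x N g.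
Proof.
move=> fg [ys [sys h]]; exists ys; split=> //; apply: le_trans sys _.
by rewrite ler_pM2r ?exprn_gt0.
Qed.

(* The words with a prefix in [us] are covered together, coarsely; those with
   another prefix are covered separately for each prefix. *)
Lemma covered_step x (E n N k : nat) us f g : `|x| + 3 <= E%:R -> (n <= N)%N ->
  uniq us -> {in us, forall u, size u = k} ->
  {in us &, forall u u', `|word_val x u - word_val x u'| < 4 ^- n} ->
  covered x n f -> covered x N g ->
  covered x (N + k) ((1 - (size us)%:R / 4 ^+ k) * g + 3 * E%:R / 4 ^+ k * f).
Proof.
move=> xE nN uus kus dus [ys0 [sys0 h0]] [ys [sys h]].
(* [L] bounds the distance to the center of a grid: the prefix, the cover of the next [n] letters
   and the last [N - n] letters contribute 1, 1 and [|x| + 1] times [4 ^ (N - n)]. *)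
pose u0 := head [::] us; pose L := (E * 4 ^ (N - n))%N.
pose grid c := projT1 (cid2 (interval_cover c L)).
pose Y1 := [seq word_val x v * 4 ^+ N + y | v <- [seq v <- words k | v \notin us], y <- ys].
pose Y2 := flatten [seq grid (word_val x u0 * 4 ^+ N + y * 4 ^+ (N - n)) | y <- ys0].
have p4 m : 0 < 4 ^+ m :> R by rewrite exprn_gt0.
exists (Y1 ++ Y2); split; last first.
  move=> w sw; pose v := take k w; pose w1 := drop k w.
  have sv : size v = k by rewrite size_take sw; case: ltnP; lia.
  have sw1 : size w1 = N by rewrite size_drop sw addnK.
  rewrite -(cat_take_drop k w) -/v -/w1 word_val_cat sw1.
  have [vus|vus] := boolP (v \in us); last first.
    have [y yy hy] := h w1 sw1; exists (word_val x v * 4 ^+ N + y).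
      rewrite mem_cat; apply/orP; left; apply: allpairs_f => //.
      by rewrite mem_filter vus mem_words sv eqxx.
    by move: hy; congr (`|_| <= 1); ring.
  have u0us : u0 \in us by rewrite /u0; case: (us) vus => //= a l _; rewrite mem_head.
  pose w2 := take n w1; pose w3 := drop n w1.
  have sw2 : size w2 = n by rewrite size_take sw1; case: ltnP => //; lia.
  have sw3 : size w3 = (N - n)%N by rewrite size_drop sw1.
  rewrite -(cat_take_drop n w1) -/w2 -/w3 word_val_cat sw3.
  have [y yy hy] := h0 w2 sw2.
  pose c := word_val x u0 * 4 ^+ N + y * 4 ^+ (N - n).
  suff hc : `|word_val x v * 4 ^+ N + (word_val x w2 * 4 ^+ (N - n) + word_val x w3) - c|
      <= L%:R.
    have [s1 s2] : size (grid c) = (2 * L).+1 /\ forall t, `|t - c| <= L%:R ->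
        exists2 y, y \in grid c & `|t - y| <= 1.
      by rewrite /grid; case: cid2.
    have [z zz hz] := s2 _ hc; exists z => //.
    rewrite mem_cat; apply/orP; right; apply/flatten_mapP; exists y => //.
  rewrite /L natrM natrX.
  have -> : word_val x v * 4 ^+ N + (word_val x w2 * 4 ^+ (N - n) + word_val x w3) - c =
    (word_val x v - word_val x u0) * 4 ^+ N + (word_val x w2 - y) * 4 ^+ (N - n)
      + word_val x w3 by rewrite /c; ring.
  have e1 : `|(word_val x v - word_val x u0) * 4 ^+ N| <= 4 ^+ (N - n).
    rewrite normrM (ger0_norm (ltW (p4 N))) -{1}(subnK nN) exprD mulrCA.
    rewrite ger_pMr // -ler_pdivlMr // mul1r.
    exact: ltW (dus _ _ vus u0us).
  have e2 : `|(word_val x w2 - y) * 4 ^+ (N - n)| <= 4 ^+ (N - n).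
    by rewrite normrM (ger0_norm (ltW (p4 _))) ger_pMl.
  have e3 := word_val_le x w3; rewrite sw3 in e3.
  have e4 : (`|x| + 3) * 4 ^+ (N - n) <= E%:R * 4 ^+ (N - n) by rewrite ler_pM2r.
  apply: le_trans e4; apply: le_trans (ler_normD _ _) _.
  have := ler_normD ((word_val x v - word_val x u0) * 4 ^+ N)
    ((word_val x w2 - y) * 4 ^+ (N - n)).
  by move: e1 e2 e3; lra.
have s1 : size Y1 = ((4 ^ k - size us) * size ys)%N.
  rewrite size_allpairs; congr (_ * _)%N.
  have -> : [seq v <- words k | v \notin us] = seq.filter (predC (mem us)) (words k) by [].
  rewrite size_filter -(size_words k) -(count_predC (mem us) (words k)).
  rewrite [X in (X + _ - _)%N](_ : _ = size us) ?addKn //.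
  rewrite -size_filter; apply: perm_size; apply: uniq_perm => //.
    by rewrite filter_uniq ?uniq_words.
  move=> u; rewrite mem_filter mem_words; apply: andb_idr => /= /kus ->.
  by rewrite eqxx.
have s2 : (size Y2 <= 3 * E * 4 ^ (N - n) * size ys0)%N.
  have -> : size Y2 = (size ys0 * (2 * L).+1)%N.
    have sg c : size (grid c) = (2 * L).+1 by rewrite /grid; case: cid2.
    rewrite /Y2 size_flatten /shape -map_comp.
    rewrite (@eq_map _ _ _ (fun=> (2 * L).+1)) => [|y /=]; last exact: sg.
    by elim: (ys0) => //= y s ->.
  rewrite mulnC leq_mul2r; apply/orP; right.
  have E0 : (0 < E)%N.
    by rewrite -(ltr_nat R); apply: lt_le_trans xE; rewrite ltr_wpDl.
  have : (0 < L)%N by rewrite /L muln_gt0 E0 expn_gt0.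
  by rewrite /L; lia.
have ks : (size us <= 4 ^ k)%N.
  rewrite -size_words; apply: uniq_leq_size => // u /kus su.
  by rewrite mem_words su.
rewrite size_cat natrD s1 natrM natrB // natrX exprD.
have s2' : (size Y2)%:R <= 3 * E%:R * f * 4 ^+ N :> R.
  apply: le_trans (_ : (3 * E * 4 ^ (N - n) * size ys0)%:R <= _); first by rewrite ler_nat.
  rewrite !natrM natrX -{2}(subnK nN) exprD.
  rewrite [leRHS](_ : _ = 3 * E%:R * 4 ^+ (N - n) * (f * 4 ^+ n)); last by ring.
  by rewrite ler_wpM2l // !mulr_ge0 // ltW.
have s1' : (4 ^+ k - (size us)%:R) * (size ys)%:R <= (4 ^+ k - (size us)%:R) * (g * 4 ^+ N).
  by rewrite ler_wpM2l // subr_ge0 -natrX ler_nat.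
apply: le_trans (lerD s1' s2') _; rewrite le_eqVlt; apply/orP; left; apply/eqP.
by field; rewrite gt_eqF.
Qed.

Lemma exprn_small (r e : R) : 0 <= r -> r < 1 -> 0 < e -> exists n : nat, r ^+ n < e.
Proof.
move=> r0 r1 e0.
have : r ^+ n @[n --> \oo] --> 0 by apply: cvg_expr; rewrite ger0_norm.
move=> /cvgrPdist_lt/(_ e e0)[n _ /(_ n (leqnn n))] /=.
by rewrite sub0r normrN ger0_norm ?exprn_ge0 // => h; exists n.
Qed.

(** With [q] the proportion of a cluster among the words of length [k], [covered_step] yields the
    map [g -> (1 - q) g + (q / 2) f], which contracts towards [f / 2]; iterating it from [f] brings
    the bound down to [3 / 4 * f]. *)
Lemma covered_reduce x n f : generic_abscissa x -> covered x n f ->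
  exists N, covered x N (3 / 4 * f).
Proof.
move=> gx cf.
have f0 : 0 <= f.
  case: cf => ys [h _]; rewrite -(pmulr_lge0 _ (_ : 0 < 4 ^+ n)) ?exprn_gt0 //.
  by apply: le_trans h; rewrite ler0n.
pose E := (Num.truncn (`|x| + 3)).+1.
have xE : `|x| + 3 <= E%:R by rewrite ltW // truncnS_gt.
have l6 : (6 * E <= 2 ^ (6 * E))%N by rewrite ltnW // ltn_expl.
have n0 : 0 < 4 ^- n :> R by rewrite invr_gt0 exprn_gt0.
(* A cluster of [2 ^ (6 E) >= 6 E] words makes [3 E / 4 ^ k] at most [q / 2]. *)
have [k [us [uus sus kus dus]]] := cluster (6 * E) gx n0.
pose q : R := (size us)%:R / 4 ^+ k.
have p4 : 0 < 4 ^+ k :> R by rewrite exprn_gt0.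
have q0 : 0 < q by rewrite divr_gt0 // sus ltr0n expn_gt0.
have q1 : q <= 1.
  rewrite ler_pdivrMr // mul1r -natrX ler_nat -size_words; apply: uniq_leq_size => // u /kus su.
  by rewrite mem_words su.
have qE : 3 * E%:R / 4 ^+ k <= q / 2.
  rewrite /q [leRHS]mulrAC ler_pM2r ?invr_gt0 // ler_pdivlMr // -!natrM ler_nat sus.
  by apply: leq_trans l6; lia.
have it j : covered x (n + j * k) (f / 2 + (1 - q) ^+ j * (f / 2)).
  elim: j => [|j IH].
    by rewrite addn0 expr0 mul1r; apply: covered_le cf; lra.
  have := covered_step xE (leq_addr _ n) uus kus dus cf IH.
  rewrite mulSn addnCA addnC -/q; apply: covered_le.
  rewrite exprS.
  have : 3 * E%:R / 4 ^+ k * f <= q / 2 * f by rewrite ler_wpM2r.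
  lra.
have [|||j hj] := @exprn_small (1 - q) 2^-1; [lra|lra|by rewrite invr_gt0|].
exists (n + j * k)%N; apply: covered_le (it j).
have : (1 - q) ^+ j * (f / 2) <= 2^-1 * (f / 2) by rewrite ler_wpM2r ?divr_ge0 // ltW.
lra.
Qed.

Lemma covered_small x f : generic_abscissa x -> 0 < f -> exists N, covered x N f.
Proof.
move=> gx f0.
have [i hi] : exists i : nat, (3 / 4) ^+ i < f by apply: exprn_small; lra.
suff [N hN] : exists N, covered x N ((3 / 4) ^+ i) by exists N; exact: covered_le (ltW hi) hN.
elim: i {hi} => [|i [N hN]].
  exists 0%N, [:: 0]; rewrite !expr0 mulr1; split => //.
  by case=> // _; exists 0; rewrite ?mem_head // /word_val /= mul0r addr0 subr0 normr0.
by rewrite exprS; exact: covered_reduce hN.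
Qed.
End Covers.

(** * From covers over abscissas to counts of grid cells *)

Section Counting.
Variable R : realType.
Local Notation mu := (@lebesgue_measure R).

Let close (c : R) (L i : nat) : bool := `|i%:R - c| <= L%:R.

Lemma count_close (c : R) (L n : nat) :
  (\sum_(i < n) close c L i <= (2 * L).+1)%N.
Proof.
have -> : (\sum_(i < n) close c L i)%N =
    size [seq i <- iota 0 n | close c L i].
  rewrite size_filter -sum1_count -[in RHS](subn0 n) -/(index_iota 0 n) [RHS]big_mkcond [RHS]big_mkord.
  by apply: eq_bigr => i _; case: close.
rewrite -[leqRHS](size_iota (Num.truncn (c - L%:R))); apply: uniq_leq_size.
  by rewrite filter_uniq ?iota_uniq.
move=> i; rewrite mem_filter !mem_iota => /andP[+ _]; rewrite /close ler_norml => /andP[h1 h2].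
have [c0|c0] := leP 0 (c - L%:R).
  have /andP[] := truncn_itv c0; set t := Num.truncn _ => t1 t2.
  apply/andP; split.
    by rewrite -(ler_nat R); lra.
  by rewrite -natr1 in t2; rewrite -(ltr_nat R) natrD -natr1 natrM; lra.
have -> : Num.truncn (c - L%:R) = 0%N by rewrite truncn_floor leNgt c0.
by rewrite add0n leq0n -(ltr_nat R) -natr1 natrM; lra.
Qed.

(** Induction on the number of cells, with [Z] cut off where the next cell begins, so that the
    measures add up. *)
Lemma measure_cells (Z : set R) (lo h : R) (A : pred nat) (n : nat) :
  0 < h -> measurable Z ->
  (forall i, (i < n)%N -> A i -> `[lo + i%:R * h, lo + i.+1%:R * h[ `<=` Z) ->
  (((\sum_(i < n) A i)%N%:R * h)%:E <= mu Z)%E.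
Proof.
move=> h0 mZ; pose W m := Z `&` `]-oo, lo + m%:R * h[.
have mW m : measurable (W m) by apply: measurableI.
suff H : forall m, (m <= n)%N -> (forall i, (i < n)%N -> A i ->
    `[lo + i%:R * h, lo + i.+1%:R * h[ `<=` Z) ->
    (((\sum_(i < m) A i)%N%:R * h)%:E <= mu (W m))%E.
  move=> cZ; apply: le_trans (H n (leqnn n) cZ) _.
  by apply: le_measure; rewrite ?inE; [exact: mW|exact: mZ|exact: subIsetl].
elim=> [|m IH] mn cZ; first by rewrite big_ord0 mul0r measure_ge0.
have mm : lo + m%:R * h <= lo + m.+1%:R * h.
  by rewrite lerD2l ler_pM2r // ler_nat.
rewrite big_ord_recr /= natrD mulrDl EFinD.
have {}IH := IH (ltnW mn) cZ.
have subW : W m `<=` W m.+1.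
  move=> x [Zx]; rewrite /= !in_itv /= => xm; split => //=; rewrite in_itv /=.
  exact: lt_le_trans xm mm.
have [Am|nAm] := boolP (A m); last first.
  rewrite mul0r adde0; apply: le_trans IH _.
  by apply: le_measure; rewrite ?inE; [exact: mW|exact: mW|exact: subW].
rewrite mul1r; pose I := `[lo + m%:R * h, lo + m.+1%:R * h[%classic : set R.
have -> : h%:E = mu I.
  rewrite lebesgue_measure_itv /= lte_fin ltrD2l ltr_pM2r // ltr_nat ltnSn.
  by rewrite -EFinB; congr (_%:E); rewrite -natr1; ring.
apply: le_trans (leeD2r _ IH) _.
rewrite -measureU; [|exact: mW|exact: measurable_itv|].
- apply: le_measure; rewrite ?inE; [by apply: measurableU; [exact: mW|exact: measurable_itv]|exact: mW|].
  move=> x [/subW //|xI]; split; first exact: cZ xI.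
  by move: xI; rewrite /I /= !in_itv /= => /andP[].
- rewrite -subset0 => x [[_]]; rewrite /I /= !in_itv /= => h1 /andP[h2 _].
  by have := lt_le_trans h1 h2; rewrite ltxx.
Qed.

(** The radius matches the Lipschitz constant [4 ^ N'] of the values of words of length [N'], so the
    cover at [x'] serves at [x] with an additional error of 1. Allowing every [N' <= N] makes the
    sets increase with [N]. *)
Definition covered_nbhd (f : R) (N : nat) : set R := [set x | exists N' x',
  [/\ (N' <= N)%N, `|x - x'| < 4 ^- N' & covered x' N' f]].

Lemma open_covered_nbhd f N : open (covered_nbhd f N).
Proof.
have -> : covered_nbhd f N = \bigcup_(p in
    [set p : nat * R | (p.1 <= N)%N /\ covered p.2 p.1 f]) ball p.2 (4 ^- p.1).
  apply/seteqP; split => [x [N' [x' [h1 h2 h3]]]|x [[N' x'] /= [h1 h2] h3]].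
    by exists (N', x') => //=; rewrite /ball /= distrC.
  by exists N', x'; split=> //; rewrite distrC.
by apply: bigcup_open => -[N' x'] _; apply: ball_open; rewrite invr_gt0 exprn_gt0.
Qed.

(** Continuity of the measure from above: the uncovered sets decrease, and every generic abscissa
    leaves them by [covered_small]. This replaces a level depending on the point by one level for
    most of the interval. *)
Lemma small_uncovered (f : R) (a b : R) : 0 < f -> exists N,
  (mu (`[a, b] `\` covered_nbhd f N) < f%:E)%E.
Proof.
move=> f0; pose V N := `[a, b] `\` covered_nbhd f N.
have mV N : measurable (V N).
  by apply: measurableD => //; apply: open_measurable; exact: open_covered_nbhd.
have decV : nonincreasing_seq V.
  apply/nonincreasing_seqP => N; rewrite subsetEset => x [abx nx]; split => //.
  by move=> [N' [x' [h1 h2 h3]]]; apply: nx; exists N', x'; split => //; exact: leqW.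
have V0 : (mu (V 0%N) < +oo)%E.
  apply: (@le_lt_trans _ _ (mu `[a, b])).
    by apply: le_measure; rewrite ?inE; [exact: mV|exact: measurable_itv|move=> x []].
  by rewrite lebesgue_measure_itv /=; case: ifP => _; rewrite ltry.
have mcap : measurable (\bigcap_n V n) by exact: bigcapT_measurable.
have cap0 : mu (\bigcap_n V n) = 0%E.
  apply: measure_negligible => //; apply: negligibleS (@negligible_not_generic R).
  move=> x Vx gx; have [N cN] := covered_small gx f0.
  have [_] := Vx N Logic.I; apply; exists N, x; split => //.
  by rewrite subrr normr0 invr_gt0 exprn_gt0.
have cv : mu \o V @ \oo --> 0%:E.
  by rewrite -[0%:E]cap0; exact: nonincreasing_cvg_mu.
have : (0%:E < f%:E)%E by rewrite lte_fin.
move=> /open_ereal_lt'/cv [N _ /(_ N (leqnn N)) hN].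
by exists N.
Qed.

Lemma row_count (J C k N n : nat) (x x' f : R) (s : R) (A : pred nat) :
  (N <= k)%N -> `|x| <= (J.+1)%:R -> `|x - x'| < 2 * 4 ^- N -> covered x' N f ->
  (forall i, (i < n)%N -> A i ->
     exists2 w, size w = k & `|i%:R - s - word_val x w| <= C%:R) ->
  (\sum_(i < n) A i)%N%:R <= 3 * (J + C + 5)%:R * f * 4 ^+ k :> R.
Proof.
(* In units of [4 ^ (k - N)], passing from [x] to [x'] costs 2, the cover 1, the last [k - N]
   letters [J + 2], and the tolerance at most [C]. *)
move=> Nk xJ xx' [ys [sys hys]] hA; pose L := (4 ^ (k - N) * (J + C + 5))%N.
have p4 m : 0 < 4 ^+ m :> R by rewrite exprn_gt0.
have le1 : (\sum_(i < n) A i <= size ys * (2 * L).+1)%N.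
  apply: (@leq_trans (\sum_(i < n) \sum_(y <- ys)
      close (s + 4 ^+ (k - N) * y)%R L i)).
    apply: leq_sum => i _; have [Ai|//] := boolP (A i).
    have [w sw hw] := hA i (ltn_ord i) Ai.
    pose v := take N w; pose u := drop N w.
    have sv : size v = N by rewrite size_take sw; case: ltnP => //; lia.
    have su : size u = (k - N)%N by rewrite size_drop sw.
    have [y yy hy] := hys v sv.
    suff h : `|i%:R - (s + 4 ^+ (k - N) * y)| <= L%:R.
      by rewrite (big_rem y) //= /close h leq_addr.
    rewrite -(cat_take_drop N w) -/v -/u word_val_cat su in hw.
    have hv := word_val_lip x x' v; have hu := word_val_le x u.
    rewrite sv in hv; rewrite su in hu.
    have e1 : `|word_val x v - word_val x' v| <= 2.
      apply: le_trans hv _; apply: le_trans (_ : 4 ^+ N * (2 * 4 ^- N) <= _).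
        by rewrite ler_pM2l // ltW.
      by rewrite mulrCA divff ?mulr1 // gt_eqF.
    have e2 : `|(word_val x v - y) * 4 ^+ (k - N)| <= 3 * 4 ^+ (k - N).
      rewrite normrM (ger0_norm (ltW (p4 _))) ler_pM2r //.
      have -> : word_val x v - y = (word_val x v - word_val x' v) + (word_val x' v - y).
        by ring.
      by apply: le_trans (ler_normD _ _) _; lra.
    have e3 : C%:R <= C%:R * 4 ^+ (k - N) :> R.
      by rewrite ler_peMr // exprn_ege1 // ler1n.
    have e4 : (`|x| + 1) * 4 ^+ (k - N) <= (J.+1%:R + 1) * 4 ^+ (k - N).
      by rewrite ler_pM2r // lerD2r.
    rewrite -[J.+1%:R]natr1 in e4; rewrite /L natrM natrX !natrD.
    have -> : i%:R - (s + 4 ^+ (k - N) * y) =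
      (i%:R - s - (word_val x v * 4 ^+ (k - N) + word_val x u)) +
      ((word_val x v - y) * 4 ^+ (k - N) + word_val x u) by ring.
    apply: le_trans (ler_normD _ _) _.
    have := ler_normD ((word_val x v - y) * 4 ^+ (k - N)) (word_val x u).
    move: hw hu e2 e3 e4; lra.
  rewrite exchange_big /=.
  apply: leq_trans (_ : \sum_(y <- ys) (2 * L).+1 <= _)%N; last first.
    by rewrite big_const_seq count_predT iter_addn_0 mulnC.
  by apply: leq_sum => y _; exact: count_close.
apply: le_trans (_ : (size ys * (3 * L))%:R <= _).
  rewrite ler_nat; apply: leq_trans le1 _; rewrite leq_mul2l; apply/orP; right.
  have : (0 < L)%N by rewrite /L muln_gt0 expn_gt0 /= addnS.
  lia.
rewrite /L !natrM natrX -[in leRHS](subnKC Nk) exprD.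
rewrite [leRHS](_ : _ = (f * 4 ^+ N) * (3 * (4 ^+ (k - N) * (J + C + 5)%:R))); last by ring.
by rewrite ler_pM2r // !mulr_gt0 // ltr0n addnS.
Qed.

(** An abscissa whose cell avoids [covered_nbhd] is allowed a full column, and such cells are few by
    measure; over the others [row_count] applies. *)
Lemma few_strip_cells (J C : nat) (eta : R) : 0 < eta -> exists k : nat,
  forall P : nat -> nat -> bool,
  (forall i i', P i i' -> exists2 w, size w = k &
     `|i'%:R - (J * 4 ^ k)%:R - word_val ((i%:R - (J * 4 ^ k)%:R) / 4 ^+ k : R) w| <= C%:R) ->
  (\sum_(i < (2 * (J * 4 ^ k)).+1) \sum_(i' < (2 * (J * 4 ^ k)).+1) P i i')%N%:R
    <= eta * 16 ^+ k.
Proof.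
(* The factor [2 J + 1] bounds the number of columns in units of [4 ^ k]; the other one adds the
   contributions [3 (J + C + 5)] and 1 of the two kinds of columns. *)
move=> eta0; pose K := ((2 * J).+1 * (3 * (J + C + 5)).+1)%N.
have K0 : 0 < K%:R :> R by rewrite ltr0n muln_gt0.
pose f := eta / K%:R; have f0 : 0 < f by rewrite divr_gt0.
(* The extra unit on the right makes room for the last cell, which starts at [J]. *)
have [k hk] := small_uncovered (- J%:R) (J%:R + 1) f0.
exists k => P hP; set S := (J * 4 ^ k)%N; set n := (2 * S).+1.
have p4 : 0 < 4 ^+ k :> R by rewrite exprn_gt0.
pose h : R := 4 ^- k; have h0 : 0 < h by rewrite invr_gt0.
pose cell (i : nat) := `[- J%:R + i%:R * h, - J%:R + i.+1%:R * h[%classic : set R.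
pose Z := `[- J%:R, J%:R + 1] `\` covered_nbhd f k.
pose B (i : nat) : bool := `[< cell i `<=` Z >].
have JS : J%:R = S%:R * h by rewrite /S /h natrM natrX mulfK // gt_eqF.
have mZ : measurable Z.
  by apply: measurableD => //; apply: open_measurable; exact: open_covered_nbhd.
have bad_le : (\sum_(i < n) B i)%N%:R <= f * 4 ^+ k.
  rewrite -ler_pdivrMr // -lee_fin; apply: le_trans (ltW hk).
  by apply: (@measure_cells Z (- J%:R) h B n) => // i _ /asboolP; apply.
have row (i : 'I_n) : (\sum_(i' < n) P i i')%N%:R <=
    3 * (J + C + 5)%:R * f * 4 ^+ k + (B i)%:R * n%:R :> R.
  have [Bi|nBi] := boolP (B i).
    rewrite mul1r; apply: ler_wpDl.
      by rewrite !mulr_ge0 // ltW.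
    rewrite ler_nat; apply: leq_trans (_ : \sum_(i' < n) 1 <= _)%N.
      by apply: leq_sum => i' _; case: (P i i').
    by rewrite sum1_card card_ord.
  rewrite mul0r addr0.
  have [t [ct Zt]] : exists t, cell i t /\ covered_nbhd f k t.
    apply: contrapT => no; move/asboolP: nBi; apply => t ct; split.
      move: ct; rewrite /cell /= !in_itv /= => /andP[t1 t2].
      have i0 : 0 <= i%:R * h by rewrite mulr_ge0 // ltW.
      have i1 : i.+1%:R * h <= 2 * J%:R + h.
        rewrite JS mulrA -[X in _ <= _ + X]mul1r -mulrDl ler_pM2r // -natrM natr1 ler_nat.
        exact: ltn_ord.
      have h1 : h <= 1 by rewrite invf_le1 // exprn_ege1 // ler1n.
      by apply/andP; split; lra.
    by move=> ut; apply: no; exists t.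
  (* [t] is within [4 ^- k] of the grid abscissa [x] and within [4 ^- N] of [x'], whence the factor
     2 in [row_count]. *)
  case: Zt => N [x' [Nk tx' cx']].
  pose x : R := (i%:R - S%:R) / 4 ^+ k.
  have xE : x = - J%:R + i%:R * h by rewrite /x JS /h; ring.
  have xt : `|x - t| <= h.
    move: ct; rewrite /cell /= in_itv /= xE -natr1 => /andP[t1 t2].
    by rewrite ler_norml; apply/andP; split; lra.
  apply: (@row_count J C k N n x x' f S%:R (P i) Nk _ _ cx'); last first.
    by move=> i' _ /hP.
  - apply: le_lt_trans (ler_distD t _ _) _.
    rewrite mulr_natl mulr2n; apply: ler_ltD => //; apply: le_trans xt _.
    by rewrite lef_pV2 ?posrE ?exprn_gt0 // ler_eXn2l // ltr1n.
  - have i0 : 0 <= i%:R * h by rewrite mulr_ge0 // ltW.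
    have i1 : i%:R * h <= 2 * J%:R.
      rewrite JS mulrA ler_pM2r // -natrM ler_nat -ltnS; exact: ltn_ord.
    by rewrite xE ler_norml -natr1; apply/andP; split; lra.
rewrite natr_sum.
apply: le_trans (ler_sum _ (fun i _ => row i)) _.
rewrite big_split /= sumr_const card_ord -mulr_suml -natr_sum -[_ *+ n]mulr_natr.
have nle : n%:R <= (2 * J).+1%:R * 4 ^+ k :> R.
  rewrite -natrX -natrM ler_nat /n /S.
  have : (0 < 4 ^ k)%N by rewrite expn_gt0.
  by move: (4 ^ k)%N => p; nia.
have -> : eta = f * K%:R by rewrite /f divfK // gt_eqF.
apply: le_trans (_ : 3 * (J + C + 5)%:R * f * 4 ^+ k * ((2 * J).+1%:R * 4 ^+ k) +
   f * 4 ^+ k * ((2 * J).+1%:R * 4 ^+ k) <= _).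
  apply: lerD; first by rewrite ler_wpM2l // !mulr_ge0 // ltW.
  by apply: ler_pM.
have -> : 16 ^+ k = 4 ^+ k * 4 ^+ k :> R by rewrite -exprMn; congr (_ ^+ _); ring.
rewrite /K natrM -[(3 * _).+1%:R]natr1 natrM le_eqVlt; apply/orP; left; apply/eqP.
by ring.
Qed.
End Counting.

(** * The Besicovitch set *)

Section Geometry.
Variable R : realType.
Implicit Types (p q v : 'rV[R]_2) (m b x y : R).

Lemma xc_pt x y : xc (pt x y) = x.
Proof. by rewrite /xc /pt mxE. Qed.

Lemma yc_pt x y : yc (pt x y) = y.
Proof. by rewrite /yc /pt mxE. Qed.

Lemma pt_eta p : p = pt (xc p) (yc p).
Proof.
by apply/rowP => -[[|[|//]] i2]; rewrite !mxE /xc /yc /=; congr (p _ _); exact/val_inj.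
Qed.

Definition on_line x y : Prop := lines_of (@F_set R) (pt x y).

Lemma B_setP p : B_set p <-> [\/ on_line (xc p) (yc p), on_line (yc p) (- xc p),
  on_line (- xc p) (yc p) | on_line (yc p) (xc p)].
Proof.
have L q : lines_of (@F_set R) q -> on_line (xc q) (yc q) by rewrite /on_line -pt_eta.
split=> [[[/L Lp|[q /L Lq <-]]|[q' [/L Lq|[q /L Lq <-]] <-]]|[]].
- by constructor 1.
- by constructor 2; rewrite /rot_half_pi xc_pt yc_pt opprK.
- by constructor 3; rewrite /refY xc_pt yc_pt opprK.
- by constructor 4; rewrite /refY /rot_half_pi !xc_pt !yc_pt opprK.
- by rewrite /on_line -pt_eta; left; left.
- by move=> h; left; right; exists (pt (yc p) (- xc p)) => //;
    rewrite /rot_half_pi xc_pt yc_pt opprK -pt_eta.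
- by move=> h; right; exists (pt (- xc p) (yc p)); [left|
    rewrite /refY xc_pt yc_pt opprK -pt_eta].
- move=> h; right; exists (rot_half_pi (pt (yc p) (xc p))); first by right; exists (pt (yc p) (xc p)).
  by rewrite /refY /rot_half_pi !xc_pt !yc_pt opprK -pt_eta.
Qed.

Lemma contraction_pt (i : 'I_4) x y :
  Defs.contraction i (pt x y) = pt ((x + (i : nat)%:R) / 4) ((y + (digit_shift i)%:R) / 4).
Proof.
rewrite /Defs.contraction; apply/rowP => -[[|[|//]] i2];
  by rewrite !mxE /= mulrC.
Qed.

Lemma F_wordP w p : F_word w p ->
  0 <= xc p * 4 ^+ size w - (word_num (@nat_of_ord 4) w)%:R <= 1 /\
  0 <= yc p * 4 ^+ size w - (word_num digit_shift w)%:R <= 1.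
Proof.
elim: w p => [|i w IH] p /=; first by rewrite !expr0 !mulr1 !subr0.
move=> [q /IH[hx hy] <-].
have -> : Defs.contraction i q =
    pt ((xc q + (i : nat)%:R) / 4) ((yc q + (digit_shift i)%:R) / 4).
  by rewrite -contraction_pt -pt_eta.
rewrite xc_pt yc_pt !natrD !natrM natrX exprS.
have E s t c : (s + c) / 4 * (4 * 4 ^+ size w) - (c * 4 ^+ size w + t) =
  s * 4 ^+ size w - t :> R by field.
by rewrite !E.
Qed.

(** The cap at 3 gives [m = 1] the expansion with all digits 3, so that the remainder stays in
    [[0, 1]]. *)
Definition slope_digit m : 'I_4 := inord (minn 3 (Num.truncn (4 * m))).

Lemma slope_digitP m : 0 <= m <= 1 -> 0 <= 4 * m - (slope_digit m : nat)%:R <= 1.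
Proof.
move=> /andP[m0 m1]; rewrite /slope_digit inordK ?ltnS ?geq_minl //.
have m40 : 0 <= 4 * m by rewrite mulr_ge0.
have /andP[t1 t2] := truncn_itv m40; set t := Num.truncn _ in t1 t2 *.
rewrite -natr1 in t2; have [t3|t3] := leqP t 3; first by apply/andP; split; lra.
by move: t3; rewrite -(ltr_nat R) => t3; apply/andP; split; lra.
Qed.

(** The base-4 digits of [m] are replaced by their images under [digit_shift]; the limit is a height
    at which [F_set] has a point over [m]. *)
Fixpoint intercept_approx (n : nat) m : R :=
  if n is n'.+1 then
    (intercept_approx n' (4 * m - (slope_digit m : nat)%:R) + (digit_shift (slope_digit m))%:R) / 4
  else 0.

Lemma digit_shift_le3 i : (digit_shift i)%:R <= 3 :> R.
Proof. by rewrite ler_nat -ltnS digit_shift_lt. Qed.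

Lemma intercept_approx_bounds n m : 0 <= intercept_approx n m <= 1.
Proof.
elim: n m => [|n IH] m /=; first by rewrite lexx ler01.
have /andP[h1 h2] := IH (4 * m - (slope_digit m : nat)%:R).
have h3 := digit_shift_le3 (slope_digit m).
by have h4 := ler0n R (digit_shift (slope_digit m)); apply/andP; split; lra.
Qed.

Lemma intercept_approx_nondecreasing m : nondecreasing_seq (intercept_approx ^~ m).
Proof.
apply/nondecreasing_seqP => n; elim: n m => [|n IH] m.
  by have /andP[] := intercept_approx_bounds 1 m.
rewrite [leLHS]/= [leRHS]/= ler_pM2r ?invr_gt0 // lerD2r; exact: IH.
Qed.

Definition intercept m : R := limn (intercept_approx ^~ m).

Lemma cvg_intercept m : intercept_approx ^~ m @ \oo --> intercept m.
Proof.
apply: nondecreasing_is_cvgn; first exact: intercept_approx_nondecreasing.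
by exists 1 => _ [n _ <-]; have /andP[] := intercept_approx_bounds n m.
Qed.

Lemma interceptE m : intercept m =
  (intercept (4 * m - (slope_digit m : nat)%:R) + (digit_shift (slope_digit m))%:R) / 4.
Proof.
have h := @cvg_intercept m; rewrite -cvg_shiftS in h.
apply: (cvg_unique _ h) => //=.
by apply: cvgMl; apply: cvgD; [exact: cvg_intercept|exact: cvg_cst].
Qed.

Lemma intercept_bounds m : 0 <= intercept m <= 1.
Proof.
apply/andP; split; [apply: limr_ge|apply: limr_le]; try exact: cvgP (@cvg_intercept m).
  by near=> n; have /andP[] := intercept_approx_bounds n m.
by near=> n; have /andP[] := intercept_approx_bounds n m.
Unshelve. all: by end_near. Qed.

(** By [interceptE] the point is the image under a contraction of the point over the remainder of
    [m], so induction on [k] places it in [F_level k]. *)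
Lemma F_set_intercept m : 0 <= m <= 1 -> F_set (pt m (intercept m)).
Proof.
move=> hm k _; elim: k m hm => [|k IH] m hm.
  by exists [::] => //=; rewrite xc_pt yc_pt; split => //; exact: intercept_bounds.
have [w /= sw Fw] := IH _ (slope_digitP hm).
exists (slope_digit m :: w); first by rewrite /= sw.
exists (pt (4 * m - (slope_digit m : nat)%:R) (intercept (4 * m - (slope_digit m : nat)%:R))) => //.
by rewrite contraction_pt -interceptE; congr pt; field.
Qed.

Lemma on_lineP x y m : 0 <= m <= 1 -> y = m * x + intercept m -> on_line x y.
Proof.
move=> hm ->; exists (pt m (intercept m)); first exact: F_set_intercept.
by rewrite /graph_line /= !xc_pt !yc_pt.
Qed.

(** The four copies of [lines_of F_set] provide the slopes in [[0, 1]], those in [[-1, 0)] and, with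
    the coordinates exchanged, the steep directions of either sign. *)
Lemma B_set_line v : v != 0 -> exists p, forall t, B_set (p + t *: v).
Proof.
move=> v0; have xcE p t : xc (p + t *: v) = xc p + t * xc v by rewrite /xc !mxE.
have ycE p t : yc (p + t *: v) = yc p + t * yc v by rewrite /yc !mxE.
have ratio a b : `|b| <= `|a| -> a != 0 -> `|b / a| <= 1 /\ b = b / a * a.
  move=> ba a0; rewrite divfK //; split => //.
  by rewrite normf_div ler_pdivrMr ?mul1r // normr_gt0.
have [h|h] := leP `|yc v| `|xc v|.
  have x0 : xc v != 0.
    apply: contra_neq v0 => x0; rewrite x0 normr0 normr_le0 in h.
    rewrite (pt_eta v) x0 (eqP h).
    by apply/rowP => -[[|[|//]] i2]; rewrite !mxE.
  have [s1 sE] := ratio _ _ h x0; set s := _ / _ in s1 sE.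
  have [s0|s0] := leP 0 s.
    rewrite ger0_norm // in s1; exists (pt 0 (intercept s)) => t; apply/B_setP; constructor 1.
    rewrite xcE ycE xc_pt yc_pt; apply: (@on_lineP _ _ s); first by rewrite s0 s1.
    by rewrite sE; ring.
  rewrite ltr0_norm // in s1; exists (pt 0 (intercept (- s))) => t; apply/B_setP; constructor 3.
  rewrite xcE ycE xc_pt yc_pt; apply: (@on_lineP _ _ (- s)); first by rewrite s1 oppr_ge0 ltW.
  by rewrite sE; ring.
have y0 : yc v != 0 by rewrite -normr_gt0; exact: le_lt_trans h.
have [s1 sE] := ratio _ _ (ltW h) y0; set s := _ / _ in s1 sE.
have [s0|s0] := leP 0 s.
  rewrite ger0_norm // in s1; exists (pt (intercept s) 0) => t; apply/B_setP; constructor 4.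
  rewrite xcE ycE xc_pt yc_pt; apply: (@on_lineP _ _ s); first by rewrite s0 s1.
  by rewrite sE; ring.
rewrite ltr0_norm // in s1; exists (pt (- intercept (- s)) 0) => t; apply/B_setP; constructor 2.
rewrite xcE ycE xc_pt yc_pt; apply: (@on_lineP _ _ (- s)); first by rewrite s1 oppr_ge0 ltW.
by rewrite sE; ring.
Qed.

(** The error [J + 3] consists of 1 for rounding [b], [J] for the position of the slope in its
    square multiplied by [x], 1 for the intercept and 1 for rounding [a]. *)
Lemma on_line_close x y (k J : nat) (a b : R) : on_line x y -> `|x| <= J%:R ->
  `|a - x * 4 ^+ k| <= 1 -> `|b - y * 4 ^+ k| <= 1 ->
  exists2 w, size w = k & `|b - word_val (a / 4 ^+ k) w| <= (J + 3)%:R.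
Proof.
move=> [q Fq]; rewrite /graph_line /= xc_pt yc_pt => yE xJ ha hb.
have [w /= sw Fw] := Fq k Logic.I; exists w => //.
have [] := F_wordP Fw; rewrite sw; set M := (word_num _ w)%:R; set B := (word_num _ w)%:R.
move=> /andP[m1 m2] /andP[c1 c2].
have p4 : 0 < 4 ^+ k :> R by rewrite exprn_gt0.
have MM : 0 <= M / 4 ^+ k <= 1.
  rewrite divr_ge0 ?ler0n ?exprn_ge0 //= ler_pdivrMr // mul1r -sw -natrX ler_nat ltnW //.
  exact: word_num_lt.
have -> : b - word_val (a / 4 ^+ k) w = (b - y * 4 ^+ k) + (xc q * 4 ^+ k - M) * x
   + (yc q * 4 ^+ k - B) - M / 4 ^+ k * (a - x * 4 ^+ k).
  by rewrite /word_val -/M -/B yE; field; rewrite gt_eqF.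
have e1 : `|(xc q * 4 ^+ k - M) * x| <= J%:R.
  by rewrite normrM ger0_norm // -[leRHS]mul1r; apply: ler_pM.
have e2 : `|M / 4 ^+ k * (a - x * 4 ^+ k)| <= 1.
  have /andP[M0 M1] := MM.
  by rewrite normrM (ger0_norm M0) -[leRHS]mul1r; apply: ler_pM.
have e3 : `|yc q * 4 ^+ k - B| <= 1 by rewrite ger0_norm.
rewrite natrD; move: e1 e2 e3 hb; rewrite !ler_norml.
move=> /andP[? ?] /andP[? ?] /andP[? ?] /andP[? ?]; apply/andP; split; lra.
Qed.
End Geometry.

(* Interpolates [digit_shift] on 0, 1, 2, 3. *)
Definition digit_fun (d : nat) : nat := (2 * (d <= 0) + 3 * (2 <= d) - 2 * (3 <= d))%N.

(** Computes the second coordinate of a corner from the first by arithmetic on digits, so that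
    numbers [m < 4 ^ k] can replace words in recursive definitions. *)
Definition shift_num (k m : nat) : nat :=
  (\sum_(0 <= j < k) digit_fun (m %/ 4 ^ j - 4 * (m %/ 4 ^ j %/ 4)) * 4 ^ j)%N.

Lemma shift_num_word w : shift_num (size w) (word_num (@nat_of_ord 4) w) =
  word_num digit_shift w.
Proof.
elim/last_ind: w => [|w i IH]; first by rewrite /shift_num big_nil.
rewrite size_rcons !word_num_rcons /shift_num big_nat_recl // expn0 divn1 muln1.
set M := word_num _ w in IH *.
have i4 := ltn_ord i.
have Mdiv : ((4 * M + i) %/ 4 = M)%N by lia.
rewrite Mdiv.
rewrite addnC addKn; congr (_ + _)%N; last first.
  by rewrite /digit_shift; case: (i : nat) i4 => [|[|[|[|]]]].
rewrite -IH /shift_num big_distrr /=; apply: eq_bigr => j _.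
by rewrite expnS divnMA Mdiv mulnCA.
Qed.

Lemma word_of_num k m : (m < 4 ^ k)%N ->
  exists2 w, size w = k & word_num (@nat_of_ord 4) w = m.
Proof.
elim: k m => [|k IH] m; first by rewrite ltnS leqn0 => /eqP ->; exists [::].
move=> mk; have [|w sw wE] := IH (m %/ 4)%N; first by rewrite ltn_divLR // -expnSr.
exists (rcons w (Ordinal (ltn_pmod m (isT : 0 < 4)%N))); first by rewrite size_rcons sw.
by rewrite word_num_rcons wE /= mulnC -divn_eq.
Qed.

(** * Recursive tests for bad squares *)

Definition half_width (j k : nat) : nat := (j.+1 * 4 ^ k)%N.

(* Coordinates are shifted by [half_width j k] to be natural numbers. *)
Definition strip_cell (j k a b : nat) : bool :=
  let S := half_width j k in
  (0 < \sum_(0 <= m < 4 ^ k)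
    (b * 4 ^ k + m * S <= S * 4 ^ k + m * a + 4 ^ k * shift_num k m + (j + 4) * 4 ^ k) *
    (S * 4 ^ k + m * a + 4 ^ k * shift_num k m <= b * 4 ^ k + m * S + (j + 4) * 4 ^ k))%N.

(** The test is the inequality multiplied by [4 ^ k], with negative terms moved across to avoid
    truncated subtraction, for some word coded by [m]. *)
Lemma strip_cellP (R : realType) j k a b :
  strip_cell j k a b <->
  exists2 w, size w = k &
    `|b%:R - (half_width j k)%:R - word_val ((a%:R - (half_width j k)%:R) / 4 ^+ k : R) w|
       <= (j + 4)%:R.
Proof.
rewrite /strip_cell; move: (half_width j k) => S.
have p4 : 0 < 4 ^+ k :> R by rewrite exprn_gt0.
have main w : size w = k -> let m := word_num (@nat_of_ord 4) w in
  (`|b%:R - S%:R - word_val ((a%:R - S%:R) / 4 ^+ k : R) w| <= (j + 4)%:R) =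
  ((b * 4 ^ k + m * S <= S * 4 ^ k + m * a +
       4 ^ k * shift_num k m + (j + 4) * 4 ^ k) &&
   (S * 4 ^ k + m * a + 4 ^ k * shift_num k m <=
       b * 4 ^ k + m * S + (j + 4) * 4 ^ k))%N.
  move=> sw m; rewrite -sw shift_num_word sw -(ler_pM2r p4).
  rewrite -[X in _ * X <= _](ger0_norm (ltW p4)) -normrM.
  rewrite -!(ler_nat R) !natrD !natrM !natrX ler_norml /word_val -/m.
  set B := (word_num digit_shift w)%:R.
  have -> : (b%:R - S%:R - (m%:R * ((a%:R - S%:R) / 4 ^+ k) + B)) * 4 ^+ k =
    b%:R * 4 ^+ k - S%:R * 4 ^+ k - m%:R * (a%:R - S%:R) - B * 4 ^+ k :> R.
    by field; rewrite gt_eqF.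
  by rewrite ?natrD; apply/andP/andP => -[h1 h2]; split; lra.
split => [|[w sw]]; last first.
  rewrite main // => /andP[h1 h2].
  have mk : (word_num (@nat_of_ord 4) w < 4 ^ k)%N by rewrite -sw word_num_lt.
  by rewrite big_mkord (bigD1 (Ordinal mk)) //= h1 h2.
rewrite lt0n big_mkord sum_nat_eq0 => /forallPn[m] /=.
rewrite -lt0n muln_gt0 !lt0b => h.
have [w sw wE] := word_of_num (ltn_ord m); exists w => //.
by rewrite main // wE.
Qed.

(** The four terms stand for the four cases of [B_setP]; subtraction from [2 * half_width j k]
    changes the sign of a coordinate. An index [t0] from 0 to [2 j] encodes the integer translation
    by [j - t0], and its successor accounts for the shift by [(j + 1) * 4 ^ k]. A positive sum
    expresses an existential quantifier and remains recursive. *)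
Definition bad_at (j k u0 u1 : nat) : bool :=
  (0 < \sum_(0 <= t0 < 2 * j + 1) \sum_(0 <= t1 < 2 * j + 1)
    (strip_cell j k (u0 + t0.+1 * 4 ^ k) (u1 + t1.+1 * 4 ^ k) +
     strip_cell j k (u1 + t1.+1 * 4 ^ k) (2 * half_width j k - (u0 + t0.+1 * 4 ^ k)) +
     strip_cell j k (2 * half_width j k - (u0 + t0.+1 * 4 ^ k)) (u1 + t1.+1 * 4 ^ k) +
     strip_cell j k (u1 + t1.+1 * 4 ^ k) (u0 + t0.+1 * 4 ^ k)))%N.

Lemma bad_atI j k u0 u1 t0 t1 (a := (u0 + t0.+1 * 4 ^ k)%N) (b := (u1 + t1.+1 * 4 ^ k)%N) :
  (t0 < 2 * j + 1)%N -> (t1 < 2 * j + 1)%N ->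
  [|| strip_cell j k a b, strip_cell j k b (2 * half_width j k - a),
      strip_cell j k (2 * half_width j k - a) b | strip_cell j k b a] ->
  bad_at j k u0 u1.
Proof.
move=> t0j t1j cells; rewrite /bad_at big_mkord (bigD1 (Ordinal t0j)) //=.
rewrite addn_gt0 big_mkord (bigD1 (Ordinal t1j)) //= -/a -/b !addn_gt0 !lt0b.
by case/or4P: cells => ->; rewrite ?orbT.
Qed.

Lemma sum_translates (K n : nat) (g : nat -> nat) :
  (\sum_(u < K) \sum_(t < n) g (u + t.+1 * K) <= \sum_(a < (n.+1 * K).+1) g a)%N.
Proof.
apply: (@leq_trans (\sum_(a < n.+1 * K) g a)); last by rewrite big_ord_recr leq_addr.
elim: n => [|n IH]; first by rewrite big1 // => u _; rewrite big_ord0.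
under eq_bigr do rewrite big_ord_recr /=.
rewrite big_split /= (_ : n.+2 * K = n.+1 * K + K)%N; last by rewrite mulSn addnC.
rewrite big_split_ord /= leq_add //.
by apply: leq_sum => u _; rewrite addnC.
Qed.

(** Different indices move the unit square to disjoint squares of the large grid, and each of the
    four tests becomes [strip_cell j k a b] after reflecting or exchanging the coordinates of that
    grid. *)
Lemma bad_at_count j k (n := (2 * half_width j k).+1) :
  (\sum_(u0 < 4 ^ k) \sum_(u1 < 4 ^ k) bad_at j k u0 u1 <=
   4 * \sum_(a < n) \sum_(b < n) strip_cell j k a b)%N.
Proof.
pose G a b := (strip_cell j k a b + strip_cell j k b (2 * half_width j k - a) +
  strip_cell j k (2 * half_width j k - a) b + strip_cell j k b a)%N.
have nE : ((2 * j + 1).+1 * 4 ^ k = 2 * half_width j k)%N by rewrite /half_width; lia.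
apply: (@leq_trans (\sum_(a < n) \sum_(b < n) G a b)%N).
  apply: (@leq_trans (\sum_(u0 < 4 ^ k) \sum_(t0 < 2 * j + 1)
      \sum_(u1 < 4 ^ k) \sum_(t1 < 2 * j + 1)
        G (u0 + t0.+1 * 4 ^ k) (u1 + t1.+1 * 4 ^ k)))%N.
    apply: leq_sum => u0 _; rewrite exchange_big /=; apply: leq_sum => u1 _.
    have E : (\sum_(0 <= t0 < 2 * j + 1) \sum_(0 <= t1 < 2 * j + 1)
        G (u0 + t0.+1 * 4 ^ k) (u1 + t1.+1 * 4 ^ k) = \sum_(t0 < 2 * j + 1)
        \sum_(t1 < 2 * j + 1) G (u0 + t0.+1 * 4 ^ k) (u1 + t1.+1 * 4 ^ k))%N.
      by rewrite big_mkord; apply: eq_bigr => t0 _; rewrite big_mkord.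
    by rewrite /bad_at -/G E; case: (\sum_(_ < _) _)%N.
  apply: leq_trans (_ : \sum_(u0 < 4 ^ k) \sum_(t0 < 2 * j + 1)
    \sum_(b < n) G (u0 + t0.+1 * 4 ^ k) b <= _)%N.
    apply: leq_sum => u0 _; apply: leq_sum => t0 _.
    apply: leq_trans (sum_translates _ _ (G (u0 + t0.+1 * 4 ^ k)%N)) _.
    by rewrite nE.
  apply: leq_trans (sum_translates _ _ (fun a => \sum_(b < n) G a b))%N _.
  by rewrite nE.
have rev (g : nat -> nat) : (\sum_(a < n) g (2 * half_width j k - a) = \sum_(a < n) g a)%N.
  rewrite [RHS](reindex_inj rev_ord_inj) /=; apply: eq_bigr => a _.
  by rewrite /n subSS.
rewrite /G; under eq_bigr do rewrite !big_split /=.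
rewrite !big_split /=; set s := (\sum_(a < n) \sum_(b < n) strip_cell j k a b)%N.
have -> : (\sum_(a < n) \sum_(b < n) strip_cell j k b (2 * half_width j k - a) = s)%N.
  rewrite exchange_big; apply: eq_bigr => a _.
  exact: (rev (fun b => strip_cell j k a b : nat)).
have -> : (\sum_(a < n) \sum_(b < n) strip_cell j k (2 * half_width j k - a) b = s)%N.
  exact: (rev (fun a => \sum_(b < n) strip_cell j k a b)%N).
by rewrite [X in (_ + X <= _)%N]exchange_big /= -/s; lia.
Qed.

Definition small_level (j k : nat) : bool :=
  ((\sum_(0 <= a < 4 ^ k) \sum_(0 <= b < 4 ^ k) bad_at j k a b) * 2 ^ j <= 4 ^ (2 * k))%N.

Lemma exists_small_level (R : realType) j : exists k, small_level j k.
Proof.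
(* The factor 4 pays for the four copies counted in [bad_at_count]. *)
have eta0 : 0 < (4 * 2 ^+ j)^-1 :> R by rewrite invr_gt0 mulr_gt0 ?exprn_gt0.
have [k hk] := few_strip_cells j.+1 (j + 4) eta0.
exists k; rewrite /small_level !big_mkord.
have {hk} := hk (fun a b => strip_cell j k a b) (fun a b => (strip_cellP R j k a b).1).
rewrite -/(half_width j k) => hk.
under eq_bigr do rewrite big_mkord.
apply: leq_trans (_ : (4 * \sum_(a < (2 * half_width j k).+1)
  \sum_(b < (2 * half_width j k).+1) strip_cell j k a b) * 2 ^ j <= _)%N.
  by rewrite leq_mul2r bad_at_count orbT.
rewrite -(ler_nat R) !natrM !natrX exprM -(natrX _ 4 2).
rewrite mulrAC -ler_pdivlMl ?mulr_gt0 ?exprn_gt0 //.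
Qed.

Lemma recfun_strip_cell : recfun (fun e => (strip_cell (nth 0 e 0) (nth 0 e 1)
  (nth 0 e 2) (nth 0 e 3) : nat))%N.
Proof. by rewrite /strip_cell /half_width; recfun_tac. Qed.

Lemma recfun_bad_at : recfun (fun e => (bad_at (nth 0 e 0) (nth 0 e 1)
  (nth 0 e 2) (nth 0 e 3) : nat))%N.
Proof.
have strip a b c d : recfun a -> recfun b -> recfun c -> recfun d ->
    recfun (fun e => strip_cell (a e) (b e) (c e) (d e) : nat).
  exact: (recfun_call4 (f := fun a b c d => strip_cell a b c d : nat) recfun_strip_cell).
apply: recfun_leq; first exact: recfun_const.
do 2!(apply: recfun_sum; first by recfun_tac).
by do ?apply: recfun_add; apply: strip; rewrite /half_width; recfun_tac.
Qed.

(** * The Besicovitch set has computable measure 0 *)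

Section Assembly.
Variable R : realType.

Definition level j : nat := ex_minn (exists_small_level R j).

(** The level is found by unbounded search for a recursive property; real analysis enters only to
    guarantee that the search ends. *)
Lemma recfun_level : recfun (fun e => level (nth 0 e 0))%N.
Proof.
apply: (@recfun_min (fun k j => small_level j k)).
- apply: recfun_leq; last by recfun_tac.
  apply: recfun_mul; last by recfun_tac.
  do 2!(apply: recfun_sum; first by recfun_tac).
  by apply: (recfun_call4 (f := fun a b c d => bad_at a b c d : nat)
    recfun_bad_at); recfun_tac.
- by move=> j; rewrite /level; case: ex_minnP.
- by move=> j k jk; rewrite /level; case: ex_minnP => m _; apply.
Qed.

Lemma computable_measure0_B : computable_measure0 (@B_set R).
Proof.
have pow2 k : (2 ^ (2 * k) = 4 ^ k)%N by rewrite expnM.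
(* Grid squares of side [4 ^- k] are dyadic squares of level [2 k]. *)
apply: (@computable_measure0_criterion R (fun j => bad_at j (level j))
  (fun j => 2 * level j)%N).
- apply: (recfun_call4 (f := fun a b c d => bad_at a b c d : nat) recfun_bad_at);
    try exact: recfun_nth.
  exact: recfun_call1 recfun_level (recfun_nth 0).
- by apply: recfun_mul (recfun_const 2) recfun_level.
- move=> j; rewrite pow2; have : small_level j (level j) by rewrite /level; case: ex_minnP.
  by rewrite /small_level big_mkord; under eq_bigr do rewrite big_mkord.
move=> x [x01 [t _ [p Bp px]]].
(* From this stage on, the translation vector [t] is among those that [bad_at] tries. *)
exists (maxn `|t 0%R 0%R|%N `|t 0%R 1%R|%N) => j u; rewrite geq_max => /andP[t0j t1j] uJ xu.
set k := level j in uJ xu *; set S := half_width j k.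
have coord i : (`|t 0%R i| <= j)%N -> exists T, [/\ (T < 2 * j + 1)%N,
    (`|u 0%R i| + T.+1 * 4 ^ k <= 2 * S)%N, `|p 0 i| <= j.+1%:R &
    `|(`|u 0%R i| + T.+1 * 4 ^ k)%N%:R - S%:R - p 0 i * 4 ^+ k| <= 1].
  move=> tj; have /andP[u0 ult] := uJ i; have /andP[h1 h2] := xu i.
  have /andP[x0 x1] := x01 i.
  have pE : p 0 i = x 0 i - (t 0 i)%:~R by rewrite -px !mxE addrK.
  have [T TE] : exists T : nat, T%:Z = j%:Z - t 0 i.
    by exists `|j%:Z - t 0%R i|%N; rewrite gez0_abs //; lia.
  have TR : T%:R = j%:R - (t 0 i)%:~R :> R by rewrite !pmulrn TE intrB.
  have uR : `|u 0%R i|%N%:R = (u 0 i)%:~R :> R by rewrite pmulrn gez0_abs.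
  have ult' : (`|u 0%R i| < 4 ^ k)%N by rewrite -pow2 in_J_absz.
  have tjR : `|(t 0 i)%:~R| <= j%:R :> R.
    by rewrite -intr_norm -[j%:R]/(j%:Z%:~R) ler_int; lia.
  exists T; split.
  - by lia.
  - rewrite /S /half_width; apply: (@leq_trans (4 ^ k + T.+1 * 4 ^ k)).
      by rewrite leq_add2r ltnW.
    by rewrite -mulSn mulnA leq_mul2r; apply/orP; right; lia.
  - rewrite pE -natr1; move: tjR; rewrite !ler_norml => /andP[? ?].
    by apply/andP; split; lra.
  - rewrite natrD natrM /S /half_width !natrM natrX -[T.+1%:R]natr1 -[j.+1%:R]natr1 TR uR pE.
    have e2 : 2 ^+ (2 * k) = 4 ^+ k :> R by rewrite -!natrX pow2.
    have p4 : 0 < 4 ^+ k :> R by rewrite exprn_gt0.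
    move: h1 h2; rewrite e2 ler_pdivrMr // ltr_pdivlMr // intrD => h1 h2.
    by rewrite ler_norml; apply/andP; split; lra.
have [T0 [T0j a2S pX Xa]] := coord 0 t0j; have [T1 [T1j b2S pY Yb]] := coord 1 t1j.
set a := (_ + _)%N in a2S Xa; set b := (_ + _)%N in b2S Yb.
rewrite -/(xc p) in pX Xa; rewrite -/(yc p) in pY Yb.
suff cells : [|| strip_cell j k a b, strip_cell j k b (2 * S - a),
    strip_cell j k (2 * S - a) b | strip_cell j k b a].
  exact: bad_atI T0j T1j cells.
have X'a : `|(2 * S - a)%N%:R - S%:R - (- xc p) * 4 ^+ k| <= 1.
  have reflect (s c y : R) : 2 * s - c - s - - y = - (c - s - y) by ring.
  by rewrite natrB // natrM mulNr reflect normrN.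
have pX' : `|- xc p| <= j.+1%:R by rewrite normrN.
have on (X Y : R) (c d : nat) : on_line X Y -> `|X| <= j.+1%:R ->
    `|c%:R - S%:R - X * 4 ^+ k| <= 1 -> `|d%:R - S%:R - Y * 4 ^+ k| <= 1 ->
    strip_cell j k c d.
  move=> XY hX hc hd; apply/(strip_cellP R).
  have [w sw hw] := on_line_close XY hX hc hd; exists w => //.
  (* The error [j.+1 + 3] of [on_line_close] for abscissas bounded by [j + 1] is the tolerance
     [j + 4] of [strip_cell]. *)
  by move: hw; rewrite addSnnS.
have /B_setP[h|h|h|h] := Bp.
- by rewrite (on _ _ _ _ h pX Xa Yb).
- by rewrite (on _ _ _ _ h pY Yb X'a) orbT.
- by rewrite (on _ _ _ _ h pX' X'a Yb) !orbT.
- by rewrite (on _ _ _ _ h pY Yb Xa) !orbT.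
Qed.
End Assembly.

Theorem theorem4 (R : realType) :
  computable_measure0 (@B_set R) /\
  (forall v : 'rV[R]_2, v != 0 ->
     exists L : set 'rV[R]_2, line_in_direction v L /\
       forall x : 'rV[R]_2, L x -> ~ computably_random x).
Proof.
split=> [|v v0]; first exact: computable_measure0_B.
have [p Bp] := B_set_line v0.
exists [set p + t *: v | t in [set: R]]; split; first by exists p.
by move=> _ [t _ <-] rnd; apply: rnd (Bp t); exact: computable_measure0_B.
Qed.
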